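(* For every mixed fair division instance $([n],[m],\mathcal{V})$ with symmetric bi-valued normalized valuations (that is, $v_i(o)\in\{-1,1\}$ for every agent $i$ and item $o$, the valuations are additive, and the instance is normalized), an EQX (hence, EQ1) complete allocation exists, and one can be computed in polynomial time.
   Context: A (mixed) fair division instance $([n],[m],\mathcal{V})$ consists of $n$ agents, a set $O=[m]$ of $m$ indivisible items, and valuations $\mathcal{V}=\{v_1,\dots,v_n\}$ with $v_i:2^{[m]}\to\mathbb{Z}$ additive: $v_i(S)=\sum_{o\in S}v_i(o)$. A (complete) allocation $A=(A_1,\dots,A_n)$ is a partition of the set of all items into $n$ (possibly empty) bundles, $A_i$ going to agent $i$. An instance is normalized if $v_i(O)$ is the same constant for all agents $i$. An allocation $A$ is EQX (equitable up to any item) if for every pair of agents $i,j$ with $v_i(A_i)<v_j(A_j)$: $v_i(A_i)\ge v_j(A_j\setminus\{g\})$ for all $g\in A_j$ with $v_j(g)\ge 0$, and $v_i(A_i\setminus\{c\})\ge v_j(A_j)$ for all $c\in A_i$ with $v_i(c)\le 0$. An allocation $A$ is EQ1 (equitable up to one item) if for every pair of agents $i,j$ with $v_i(A_i)<v_j(A_j)$, either there exists $g\in A_j$ with $v_j(g)\ge 0$ such that $v_i(A_i)\ge v_j(A_j\setminus\{g\})$, or there exists $c\in A_i$ with $v_i(c)\le 0$ such that $v_i(A_i\setminus\{c\})\ge v_j(A_j)$. *)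

(* Defs.v *)
From HB Require Import structures.
From mathcomp Require Import all_boot all_order all_algebra.

Set Implicit Arguments.
Unset Strict Implicit.
Unset Printing Implicit Defensive.

Import Order.TTheory GRing.Theory Num.Theory.
Local Open Scope ring_scope.

(** * Fair division *)

(* There is at least one agent: with none, no complete allocation of a
   nonempty set of items could exist. *)
Record fd_instance := FDInstance {
  agents : nat;
  items : nat;
  valuation : 'I_agents -> {set 'I_items} -> int;
  agents_gt0 : (0 < agents)%N;
  valuation_additive : forall (i : 'I_agents) (S : {set 'I_items}),
    valuation i S = \sum_(o in S) valuation i [set o]
}.

Definition symmetric_bivalued (I : fd_instance) : Prop :=
  forall (i : 'I_(agents I)) (o : 'I_(items I)),
    valuation i [set o] = -1 \/ valuation i [set o] = 1.

Definition normalized (I : fd_instance) : Prop :=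
  forall i j : 'I_(agents I), valuation i [set: 'I_(items I)] = valuation j [set: 'I_(items I)].

Definition bundles (I : fd_instance) : Type := 'I_(agents I) -> {set 'I_(items I)}.

(* Bundles may be empty, so finset's [partition] does not apply. *)
Definition complete_allocation (I : fd_instance) (A : bundles I) : Prop :=
  (forall i j, i != j -> [disjoint A i & A j]) /\
  \bigcup_i A i = [set: 'I_(items I)].

Definition EQX (I : fd_instance) (A : bundles I) : Prop :=
  forall i j : 'I_(agents I), valuation i (A i) < valuation j (A j) ->
    (forall g, g \in A j -> 0 <= valuation j [set g] ->
       valuation j (A j :\ g) <= valuation i (A i)) /\
    (forall c, c \in A i -> valuation i [set c] <= 0 ->
       valuation j (A j) <= valuation i (A i :\ c)).

Definition EQ1 (I : fd_instance) (A : bundles I) : Prop :=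
  forall i j : 'I_(agents I), valuation i (A i) < valuation j (A j) ->
    (exists g, [/\ g \in A j, 0 <= valuation j [set g] &
       valuation j (A j :\ g) <= valuation i (A i)]) \/
    (exists c, [/\ c \in A i, valuation i [set c] <= 0 &
       valuation j (A j) <= valuation i (A i :\ c)]).

(** * Polynomial-time computation

   The machine model is a random access machine with structured control.  The
   memory consists of arrays, named by natural numbers and indexed by integers,
   whose cells hold integers; a program names finitely many arrays.  Every
   constant, memory access, arithmetic operation and test has unit cost.  As
   addition and subtraction are the only arithmetic operations, the bit length
   of a stored integer grows by at most a constant per unit of cost, so
   polynomial time on this machine is polynomial time on a Turing machine. *)

Definition store : Type := nat -> int -> int.

Inductive expr : Type :=
  | Const of int
  | Get of nat & expr
  | Plus of expr & expr
  | Minus of expr & expr.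

(* [If e] and [While e] test whether e is positive. *)
Inductive cmd : Type :=
  | Skip
  | Put of nat & expr & expr
  | Seq of cmd & cmd
  | If of expr & cmd & cmd
  | While of expr & cmd.

Fixpoint eval (s : store) (e : expr) : int :=
  match e with
  | Const z => z
  | Get a e1 => s a (eval s e1)
  | Plus e1 e2 => eval s e1 + eval s e2
  | Minus e1 e2 => eval s e1 - eval s e2
  end.

Fixpoint cost (e : expr) : nat :=
  match e with
  | Const _ => 1%N
  | Get _ e1 => (cost e1).+1
  | Plus e1 e2 | Minus e1 e2 => (cost e1 + cost e2).+1%N
  end.

Definition update (s : store) (a : nat) (x z : int) : store :=
  fun b y => if (b == a) && (y == x) then z else s b y.

(* [exec p s t s']: p started in s halts in s' at total cost t. *)
Inductive exec : cmd -> store -> nat -> store -> Prop :=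
  | ExecSkip s : exec Skip s 1 s
  | ExecPut a e1 e2 s :
      exec (Put a e1 e2) s (cost e1 + cost e2).+1%N
        (update s a (eval s e1) (eval s e2))
  | ExecSeq p q s s1 s2 t1 t2 :
      exec p s t1 s1 -> exec q s1 t2 s2 -> exec (Seq p q) s (t1 + t2)%N s2
  | ExecIfTrue e p q s s1 t :
      0 < eval s e -> exec p s t s1 -> exec (If e p q) s (cost e + t).+1%N s1
  | ExecIfFalse e p q s s1 t :
      ~~ (0 < eval s e) -> exec q s t s1 ->
      exec (If e p q) s (cost e + t).+1%N s1
  | ExecWhileTrue e p s s1 s2 t1 t2 :
      0 < eval s e -> exec p s t1 s1 -> exec (While e p) s1 t2 s2 ->
      exec (While e p) s (cost e + t1 + t2).+1%N s2
  | ExecWhileFalse e p s :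
      ~~ (0 < eval s e) -> exec (While e p) s (cost e).+1 s.

(* An array holds the word w when its cell 0 contains the length of w and the
   letters of w follow.  The input is in array 0, all other cells being 0; the
   output is read from array 1. *)
Definition input (w : seq int) : store := fun a x =>
  match a, x with
  | 0%N, Posz k => nth 0 ((size w)%:Z :: w) k
  | _, _ => 0
  end.

Definition outputs (s : store) (w : seq int) : Prop :=
  forall k : nat, (k <= size w)%N -> s 1%N k%:Z = nth 0 ((size w)%:Z :: w) k.

(* Binary length, with one more symbol per letter for the sign. *)
Definition bit_length (w : seq int) : nat :=
  (\sum_(z <- w) (trunc_log 2 `|z|).+2)%N.

(* One program solves all inputs x satisfying dom: it returns some word y with
   sol x y, within a time polynomial in the bit length of the encoding of x. *)
Definition poly_time_solvable (X : Type) (dom : X -> Prop)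
    (enc : X -> seq int) (sol : X -> seq int -> Prop) : Prop :=
  exists (p : cmd) (c d : nat), forall x : X, dom x ->
    exists (t : nat) (s : store) (y : seq int),
      [/\ exec p (input (enc x)) t s,
          (t <= c * bit_length (enc x) ^ d + c)%N,
          outputs s y
        & sol x y].

(* The number of agents, the number of items, then the agents' values for the
   items, agent by agent. *)
Definition encode_instance (I : fd_instance) : seq int :=
  [:: (agents I)%:Z, (items I)%:Z &
    [seq valuation i [set o] | i <- enum 'I_(agents I), o <- enum 'I_(items I)]].

(* An allocation is encoded by the list of the owners of items 0, 1, ... *)
Definition encodes_allocation (I : fd_instance) (A : bundles I)
    (w : seq int) : Prop :=
  size w = items I /\
  forall (i : 'I_(agents I)) (o : 'I_(items I)),
    o \in A i -> nth 0 w o = (i : nat)%:Z.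

(* Main.v *)
Require Import Defs.
From mathcomp Require Import all_boot all_order all_algebra.
From mathcomp Require Import zify ring.

(* As all values are 1 or -1, an allocation is EQX as soon as the agents' values
   all lie in {q, q+1} for some q.  Let K be the common value of the set of all
   items and q a lower rounding of K/n.  Giving every agent the fraction 1/n of
   every item yields value K/n to everyone; it remains to round this.

   Every item is doubled, into copies with owners A and B.  The two copies are
   balanced against each other on a bipartite double cover with a node (i, s) for
   every agent i and sign s: copy A of an item owned by i adds one unit to the
   node (i, +) if i likes the item and to (i, -) otherwise; copy B removes a unit
   from (i, -) if i likes the item and from (i, +) otherwise.  Reassigning a copy
   moves one unit between nodes, so this is a network flow problem, for which the
   fractional solution is feasible; a push-relabel algorithm solves it, once for
   the upper bounds and, after exchanging A and B, once for the lower bounds.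

   Counting both copies, every agent then has a value in [2q, 2q+2].  The items
   whose copies have different owners are the edges of a graph on the agents.
   They are given to one of their two owners along a walk: only the current
   agent may be out of range, by one; it then has odd value, hence an undecided
   item, and that item is decided so as to bring it back into range, which
   displaces the other owner by one, the next agent of the walk.  At the end all
   values are even, that is, 2q or 2q+2. *)

Set Implicit Arguments.
Unset Strict Implicit.
Unset Printing Implicit Defensive.

Import Order.TTheory GRing.Theory Num.Theory.
Local Open Scope ring_scope.

(** * Running time of structured programs *)

(* Valid for executions in which every loop makes at most [B] iterations. *)
Fixpoint time_bound (B : nat) (c : cmd) : nat :=
  match c with
  | Skip => 1
  | Put _ e1 e2 => (cost e1 + cost e2).+1
  | Seq p q => time_bound B p + time_bound B q
  | If e p q => (cost e + (time_bound B p + time_bound B q)).+1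
  | While e p => B.+1 * (cost e + time_bound B p).+1
  end.

(** By induction on the program: a loop raises the degree by one, and [mono] puts the bounds of two
    subprograms under a common one by adding coefficients and exponents. *)
Lemma time_bound_poly c :
  exists b d, forall B, (0 < B)%N -> (time_bound B c <= b * B ^ d + b)%N.
Proof.
have mono b d b' d' B : (0 < B)%N ->
    (b * B ^ d + b <= (b + b') * B ^ (d + d') + (b + b'))%N.
  by move=> B0; apply: leq_add; rewrite ?leq_addr ?leq_mul ?leq_addr ?leq_pexp2l ?leq_addr.
elim: c => [|a e1 e2|p [b1 [d1 H1]] q [b2 [d2 H2]]
  |e p [b1 [d1 H1]] q [b2 [d2 H2]]|e p [b [d H]]].
- by exists 1%N, 0%N.
- exists (cost e1 + cost e2).+1, 0%N => B B0 /=; lia.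
- exists ((b1 + b2) + (b2 + b1))%N, (d1 + d2)%N => B B0 /=.
  have := mono b1 d1 b2 d2 B B0; have := mono b2 d2 b1 d1 B B0.
  rewrite (addnC d2 d1); have := H1 B B0; have := H2 B B0; lia.
- exists ((cost e).+1 + ((b1 + b2) + (b2 + b1)))%N, (d1 + d2)%N => B B0 /=.
  have := mono b1 d1 b2 d2 B B0; have := mono b2 d2 b1 d1 B B0.
  rewrite (addnC d2 d1); have := H1 B B0; have := H2 B B0; lia.
- pose k := ((cost e).+1 + b)%N; exists (4 * k)%N, d.+1 => B B0 /=.
  have hB := H B B0.
  have P0 : (0 < B ^ d)%N by rewrite expn_gt0 B0.
  rewrite expnS; move: (B ^ d)%N hB P0 => P hB P0.
  have h1 : ((cost e + time_bound B p).+1 <= 2 * k * P)%N by rewrite /k; nia.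
  have h2 : (B.+1 <= 2 * B)%N by lia.
  have := leq_mul h2 h1; nia.
Qed.

(** * Weakest preconditions under a bound on loop iterations *)

Definition runs (B : nat) (c : cmd) (s : store) (Q : store -> Prop) : Prop :=
  exists t s', [/\ exec c s t s', (t <= time_bound B c)%N & Q s'].

(** A loop is left as a bare [runs] obligation, so invariants enter only through [wp_while]; all
    other commands are handled by computation. *)
Fixpoint wp (B : nat) (c : cmd) (s : store) (Q : store -> Prop) : Prop :=
  match c with
  | Skip => Q s
  | Put a e1 e2 => Q (update s a (eval s e1) (eval s e2))
  | Seq p q => wp B p s (fun s' => wp B q s' Q)
  | If e p q => if 0 < eval s e then wp B p s Q else wp B q s Q
  | While e p => runs B (While e p) s Q
  end.

Lemma wp_seq B p q s Q : wp B (Seq p q) s Q = wp B p s (fun s' => wp B q s' Q).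
Proof. by []. Qed.

Lemma wp_put B a e1 e2 s Q :
  wp B (Put a e1 e2) s Q = Q (update s a (eval s e1) (eval s e2)).
Proof. by []. Qed.

Lemma wp_if B e p q s Q :
  wp B (If e p q) s Q = if 0 < eval s e then wp B p s Q else wp B q s Q.
Proof. by []. Qed.

Lemma runs_mono B c s (Q Q' : store -> Prop) :
  (forall s', Q s' -> Q' s') -> runs B c s Q -> runs B c s Q'.
Proof. by move=> QQ' [t [s' [? ? /QQ' ?]]]; exists t, s'. Qed.

Lemma wp_mono B c s (Q Q' : store -> Prop) :
  (forall s', Q s' -> Q' s') -> wp B c s Q -> wp B c s Q'.
Proof.
elim: c s Q Q' => [|a e1 e2|p IHp q IHq|e p IHp q IHq|e p _] s Q Q' QQ' /=.
- exact: QQ'.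
- exact: QQ'.
- by apply: IHp => s'; apply: IHq.
- by case: ifP => _; [apply: IHp|apply: IHq].
- exact: runs_mono.
Qed.

Lemma wp_runs B c s Q : wp B c s Q -> runs B c s Q.
Proof.
elim: c s Q => [|a e1 e2|p IHp q IHq|e p IHp q IHq|e p _] s Q //=.
- by move=> Qs; exists 1%N, s; split=> //; constructor.
- move=> Qs; eexists; eexists; split; [constructor| |exact: Qs] => //.
- move=> /IHp [t1 [s1 [E1 T1 /IHq [t2 [s2 [E2 T2 Qs2]]]]]].
  exists (t1 + t2)%N, s2; split=> //; last exact: leq_add.
  exact: ExecSeq E1 E2.
- case: ifPn => He; [move=> /IHp|move=> /IHq] => -[t [s1 [E T Qs]]];
    exists (cost e + t).+1, s1; split=> //=.
  + exact: ExecIfTrue.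
  + by rewrite ltnS leq_add2l (leq_trans T) ?leq_addr.
  + exact: ExecIfFalse.
  + by rewrite ltnS leq_add2l (leq_trans T) ?leq_addl.
Qed.

Lemma wp_while B e p (I : nat -> store -> Prop) (Q : store -> Prop) k s :
  (k <= B)%N -> I k s ->
  (forall k s, I k s -> 0 < eval s e ->
     wp B p s (fun s' => exists2 k', (k' < k)%N & I k' s')) ->
  (forall k s, I k s -> ~~ (0 < eval s e) -> Q s) ->
  wp B (While e p) s Q.
Proof.
move=> kB Iks Hbody Hexit /=.
(* The measure [k] bounds the number of iterations to come. The induction needs the time bound with
   [k] in place of [B]; [k <= B] then weakens it. *)
suff [t [s' [E T Qs]]] : exists t s', [/\ exec (While e p) s t s',
    (t <= k.+1 * (cost e + time_bound B p).+1)%N & Q s'].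
  by exists t, s'; split=> //=; apply: leq_trans T _; rewrite leq_mul2r ltnS kB orbT.
elim/ltn_ind: k s Iks {kB} => k IH s Iks.
have [He|He] := boolP (0 < eval s e); last first.
  exists (cost e).+1, s; split; [exact: ExecWhileFalse| by nia|exact: Hexit Iks He].
have [t1 [s1 [E1 T1 [k' lt_k'k Ik']]]] := wp_runs (Hbody _ _ Iks He).
have [t2 [s2 [E2 T2 Qs2]]] := IH _ lt_k'k _ Ik'.
exists (cost e + t1 + t2).+1, s2; split=> //; first exact: ExecWhileTrue E1 E2.
apply: leq_trans (_ : (cost e + time_bound B p).+1 +
   k'.+1 * (cost e + time_bound B p).+1 <= _)%N; first by lia.
by rewrite -mulSn leq_mul2r ltnS lt_k'k orbT.
Qed.

Local Notation Var x := (Get x (Const 0)).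
Local Notation Set_ x e := (Put x (Const 0) e).

Definition For (x : nat) (e : expr) (p : cmd) : cmd :=
  Seq (Set_ x (Const 1))
    (While (Plus (Minus e (Var x)) (Const 1))
       (Seq p (Set_ x (Plus (Var x) (Const 1))))).

(** [I j] holds after [j] passes, when the counter, which starts from 1, is [j.+1]. The invariant
    must not depend on the cell of the counter, and the body must leave the counter as it found
    it. *)
Lemma wp_for B x e p N (I : nat -> store -> Prop) (Q : store -> Prop) s :
  (N <= B)%N ->
  (forall j s z, I j s -> I j (update s x 0 z)) ->
  I 0%N s ->
  (forall j s, I j s -> eval s e = N%:Z) ->
  (forall j s, (j < N)%N -> I j s -> s x 0 = j.+1%:Z ->
     wp B p s (fun s' => I j.+1 s' /\ s' x 0 = j.+1%:Z)) ->
  (forall s, I N s -> Q s) ->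
  wp B (For x e p) s Q.
Proof.
move=> NB Ix I0 Ie Ip IQ.
pose J k s := [/\ (k <= N)%N, I (N - k)%N s & s x 0 = (N - k).+1%:Z].
rewrite /For [wp _ _ _ _]/=.
apply: (@wp_while B _ _ J _ N _ NB).
- by split=> //; rewrite subnn; [apply: Ix|rewrite /update !eqxx].
- move=> k s1 [kN Ik xk] /=; rewrite (Ie _ _ Ik) xk => He.
  have k0 : (0 < k)%N by lia.
  apply: wp_mono (Ip _ _ _ Ik xk); last by lia.
  move=> s2 [I2 x2] /=; exists k.-1; first by lia.
  have Ek : (N - k).+1 = (N - k.-1)%N by lia.
  rewrite Ek in I2 x2.
  split; [by lia|exact: Ix|].
  rewrite /update !eqxx /= x2; lia.
- move=> k s1 [kN Ik xk] /=; rewrite (Ie _ _ Ik) xk => He.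
  apply: IQ; have k0 : k = 0%N by lia.
  by rewrite k0 subn0 in Ik.
Qed.

(** * Balancing the two copies *)

Definition assign (I : eqType) (T : Type) (f : I -> T) (i : I) (x : T) : I -> T :=
  fun j => if j == i then x else f j.

Definition pos_part (z : int) : nat := if z is Posz k then k else 0.
Arguments pos_part : simpl never.

Section Balancing.

Variables (n m : nat) (good : 'I_n -> 'I_m -> bool) (q : int).
Local Notation node := ('I_n * bool)%type.
Implicit Types (A B : 'I_m -> 'I_n) (l : node -> int) (h : node -> nat).

Definition loc (a : 'I_n) (o : 'I_m) : node := (a, good a o).
Definition opp (p : node) : node := (p.1, ~~ p.2).
(* Shifts the target ranges [q, q+1] of the nodes (i, +) and [-q-1, -q] of the
   nodes (i, -) to [-1, 0]. *)
Definition offset (p : node) : int := if p.2 then - q - 1 else q.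
Definition load A B (p : node) : int :=
  \sum_o ((loc (A o) o == p)%:R - (opp (loc (B o) o) == p)%:R) + offset p.

Lemma sum_assign (F : 'I_m -> 'I_n -> int) A o b :
  \sum_j F j (assign A o b j) = \sum_j F j (A j) - F o (A o) + F o b.
Proof.
rewrite (bigD1 o) //= [in RHS](bigD1 o) //= /assign eqxx.
rewrite (eq_bigr (fun j => F j (A j))); first by ring.
by move=> j /negPf ->.
Qed.

Lemma load_assignl A B o b p :
  load (assign A o b) B p
  = load A B p - (loc (A o) o == p)%:R + (loc b o == p)%:R.
Proof.
rewrite /load (sum_assign (fun j a => (loc a j == p)%:R - (opp (loc (B j) j) == p)%:R)).
ring.
Qed.

Lemma load_assignr A B o b p :
  load A (assign B o b) p
  = load A B p - (opp (loc b o) == p)%:R + (opp (loc (B o) o) == p)%:R.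
Proof.
rewrite /load (sum_assign (fun j a => (loc (A j) j == p)%:R - (opp (loc a j) == p)%:R)).
ring.
Qed.

Lemma oppK : involutive opp.
Proof. by case=> a s; rewrite /opp /= negbK. Qed.

Lemma opp_eq p p' : (opp p == p') = (p == opp p').
Proof. by rewrite (can2_eq oppK oppK). Qed.

(** The offsets of opposite nodes add up to -1. Hence exchanging the copies reflects the range
    [-1, 0] onto itself and turns upper bounds on loads into lower bounds. *)
Lemma load_swap A B p : load B A p = -1 - load A B (opp p).
Proof.
rewrite /load /= opprD addrA -sumrN.
under [in RHS]eq_bigr => o _ do rewrite opprB opp_eq oppK -opp_eq.
by rewrite /offset /=; case: p.2 => /=; ring.
Qed.

(* A unit of load can move from [p] to [p'] iff some copy of an item can be
   reassigned with that effect; labels drop by at most one along such moves. *)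
Definition valid A B h : Prop := forall o b,
  (h (loc (A o) o) <= (h (loc b o)).+1)%N /\
  (h (opp (loc b o)) <= (h (opp (loc (B o) o))).+1)%N.

(** Both operations lower it. A push carries a unit of excess to a smaller label, which lowers the
    second term; raising a label by one lowers the first term by [2 * m + 1] and increases the
    second by the load, at most [2 * m]. *)
Definition potential l h : nat :=
  (\sum_p ((2 * m).+1 * (2 * n - h p) + pos_part (l p) * h p))%N.

Lemma potential_push l h x y :
  0 < l x -> (h y < h x)%N ->
  (potential (fun p => (l p - (x == p)%:R + (y == p)%:R)%R) h < potential l h)%N.
Proof.
move=> lx hyx; have xy : y != x by apply: contraTneq hyx => ->; rewrite ltnn.
rewrite /potential (bigD1 x) // [ltnRHS](bigD1 x) //=.
rewrite (bigD1 y) //= [in ltnRHS](bigD1 y) //=.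
rewrite (eq_bigr (fun p => (2 * m).+1 * (2 * n - h p) + pos_part (l p) * h p)%N); last first.
  by move=> p /andP[px py]; rewrite !(eq_sym _ p) (negPf px) (negPf py) subr0 addr0.
rewrite !eqxx (eq_sym x y) (negPf xy) /= subr0 addr0.
(* The excess of [x] falls by exactly one because its load is positive; that of [y] may stay 0, so
   only an inequality holds there. *)
have ex : (pos_part (l x - 1)).+1 = pos_part (l x).
  by case: (l x) lx => [[|k]|k] // _; have -> : k.+1%:Z - 1 = k%:Z by lia.
have ey : (pos_part (l y + 1) <= (pos_part (l y)).+1)%N.
  by case: (l y) => [k|[|k]] //; have -> : k%:Z + 1 = k.+1%:Z by lia.
set S := (\sum_(i | _) _)%N; rewrite -ex.
have := leq_mul ey (leqnn (h y)).
move: (_ * (_ - h x))%N (_ * (_ - h y))%N S {ex ey} (pos_part _) (pos_part _) (pos_part _).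
move=> u v S a b c; rewrite !mulSn; lia.
Qed.

Lemma eq_potential l l' h : l =1 l' -> potential l h = potential l' h.
Proof. by move=> E; apply: eq_bigr => p _; rewrite E. Qed.

Definition labelled A B h : Prop :=
  [/\ valid A B h, forall x, (0 < h x)%N -> 0 <= load A B x
    & forall x, (h x <= 2 * n)%N].

(** The new owner's node has a smaller label than the old one's, so validity survives. Only a node
    of positive load loses a unit, so a lower bound of -1 survives as well; the second run of the
    balancing relies on this. *)
Lemma push_left A B h o b :
  labelled A B h -> 0 < load A B (loc (A o) o) ->
  (h (loc b o) < h (loc (A o) o))%N ->
  let A' := assign A o b in
  [/\ labelled A' B h, (potential (load A' B) h < potential (load A B) h)%N
    & (forall p, -1 <= load A B p) -> forall p, -1 <= load A' B p].
Proof.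
move=> [hV h0 hb] lx hlt A'.
have E p : load A' B p = load A B p - (loc (A o) o == p)%:R + (loc b o == p)%:R.
  exact: load_assignl.
have neq : loc b o != loc (A o) o by apply: contraTneq hlt => ->; rewrite ltnn.
split.
- split=> // [j c|x hx].
    have [V1 V2] := hV j c; split=> //.
    by rewrite /A' /assign; case: eqP => // jo; subst j; lia.
  have := h0 x hx; rewrite E; have [<-|_] := eqVneq (loc (A o) o) x.
    by rewrite (negPf neq); lia.
  case: eqP => _ /=; lia.
- by rewrite (eq_potential _ E) potential_push.
- move=> H p; have := H p; rewrite E; have [<-|_] := eqVneq (loc (A o) o) p.
    by rewrite (negPf neq); lia.
  case: eqP => _ /=; lia.
Qed.

Lemma push_right A B h o b :
  labelled A B h -> 0 < load A B (opp (loc b o)) ->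
  (h (opp (loc (B o) o)) < h (opp (loc b o)))%N ->
  let B' := assign B o b in
  [/\ labelled A B' h, (potential (load A B') h < potential (load A B) h)%N
    & (forall p, -1 <= load A B p) -> forall p, -1 <= load A B' p].
Proof.
move=> [hV h0 hb] lx hlt B'.
have E p : load A B' p
    = load A B p - (opp (loc b o) == p)%:R + (opp (loc (B o) o) == p)%:R.
  exact: load_assignr.
have neq : opp (loc (B o) o) != opp (loc b o).
  by apply: contraTneq hlt => ->; rewrite ltnn.
split.
- split=> // [j c|x hx].
    have [V1 V2] := hV j c; split=> //.
    by rewrite /B' /assign; case: eqP => // jo; subst j; lia.
  have := h0 x hx; rewrite E; have [<-|_] := eqVneq (opp (loc b o)) x.
    by rewrite (negPf neq); lia.
  case: eqP => _ /=; lia.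
- by rewrite (eq_potential _ E) potential_push.
- move=> H p; have := H p; rewrite E; have [<-|_] := eqVneq (opp (loc b o)) p.
    by rewrite (negPf neq); lia.
  case: eqP => _ /=; lia.
Qed.

Definition stuck A B h o b : Prop :=
  (0 < load A B (loc (A o) o) -> (h (loc (A o) o) <= h (loc b o))%N) /\
  (0 < load A B (opp (loc b o)) ->
     (h (opp (loc b o)) <= h (opp (loc (B o) o)))%N).

Definition relabel l h (p : node) : nat := (h p + (0 < l p)%R)%N.

Lemma potential0 l h : (forall p, h p = 0%N) ->
  potential l h = (2 * n * ((2 * m).+1 * (2 * n)))%N.
Proof.
move=> E; rewrite /potential (eq_bigr (fun=> (2 * m).+1 * (2 * n))%N); last first.
  by move=> p _; rewrite E subn0 muln0 addn0.
by rewrite sum_nat_const card_prod card_ord card_bool (mulnC n).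
Qed.

(** * Gains of the agents and the walk through the undecided items *)

Definition gain A B (x : 'I_n) : int :=
  \sum_o (if good x o then 1 else -1) * ((A o == x)%:R + (B o == x)%:R)
  - 2 * q - 1.

(** The gain is the value of both copies minus [2 * q + 1], the centre of the range [2q, 2q+2]. As
    it is a difference of two loads, loads in [-1, 0] give gains in [-1, 1]. *)
Lemma gain_load A B x : gain A B x = load A B (x, true) - load A B (x, false).
Proof.
rewrite /gain /load /offset /= opprD addrACA -sumrB.
rewrite (_ : _ - 2 * q - 1 = \sum_o (if good x o then 1 else -1) *
  ((A o == x)%:R + (B o == x)%:R) + (- q - 1 - q)); last by ring.
congr (_ + _); apply: eq_bigr => o _; rewrite /loc /opp !xpair_eqE /=.
case: (eqVneq (A o) x) => [->|_]; case: (eqVneq (B o) x) => [->|_];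
  by case: (good _ _).
Qed.

Definition share A (x : 'I_n) : int :=
  \sum_(o | A o == x) (if good x o then 1 else -1).

Lemma gain_decided A B x : (forall o, A o = B o) -> gain A B x = 2 * (share A x - q) - 1.
Proof.
move=> AB; rewrite /gain mulrBr; congr (_ - _ - _).
rewrite /share [in RHS]big_mkcond mulr_sumr; apply: eq_bigr => o _.
rewrite -AB; case: eqP => _ /=; ring.
Qed.

Definition undecided A B : nat := (\sum_o (A o != B o))%N.

Lemma gain_resolve A B c g y z :
  g != y -> A c = g /\ B c = y \/ A c = y /\ B c = g ->
  gain (assign A c g) (assign B c g) z =
  gain A B z + (if good g c then 1 else -1) * (g == z)%:R
             - (if good y c then 1 else -1) * (y == z)%:R.
Proof.
move=> gy AB; rewrite /gain.
pose F o (u v : 'I_n) : int := (if good z o then 1 else -1) * ((u == z)%:R + (v == z)%:R).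
have -> : \sum_o F o (assign A c g o) (assign B c g o)
    = \sum_o F o (A o) (B o) - F c (A c) (B c) + F c g g.
  rewrite (bigD1 c) //= [in RHS](bigD1 c) //= /assign eqxx.
  rewrite (eq_bigr (fun o => F o (A o) (B o))); first by ring.
  by move=> j /negPf ->.
have -> : F c (A c) (B c) = F c g y.
  by case: AB => -[-> ->] //; rewrite /F addrC.
rewrite /F; have [<-|gz] := eqVneq g z.
  by rewrite eq_sym (negPf gy) /=; case: ifP => _; ring.
have [<-|yz] := eqVneq y z; first by case: ifP => _ /=; ring.
by rewrite /=; ring.
Qed.

(* Only the current agent [a] of the walk may be one unit out of range, and an
   agent without undecided items has an odd gain, hence is in range. *)
Definition walk A B (a : 'I_n) : Prop :=
  forall z, - 1 - (z == a)%:R <= gain A B z <= 1 + (z == a)%:R.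

Lemma walk_settled A B a :
  walk A B a -> (forall o, A o != B o -> A o != a /\ B o != a) ->
  forall z, -1 <= gain A B z <= 1.
Proof.
move=> W H z; have := W z; have [->|_] := eqVneq z a; last by rewrite subr0 addr0.
(* Every item of [a] is decided and counts twice, so the gain is [2 * (D - q) - 1]. An odd number in
   [-2, 2] lies in [-1, 1]. *)
pose D : int := \sum_o (if good a o then 1 else -1) * (A o == a)%:R.
have -> : gain A B a = 2 * (D - q) - 1; last by lia.
rewrite /gain mulrBr mulr_sumr; congr (_ - _ - _).
apply: eq_bigr => o _; have [->|/H[/negPf -> /negPf ->]] := eqVneq (A o) (B o).
  ring.
by rewrite addr0 !mulr0.
Qed.

(** [g] is chosen so that the gain of [x] decreases by one if positive and increases by one
    otherwise, which brings it into [-1, 1]. The gain of [y] changes by one in either direction, so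
    [y] becomes the current agent. If [a] has no undecided item, the walk restarts from any
    undecided one. *)
Lemma walk_step A B a c x y :
  walk A B a -> x != y -> A c = x /\ B c = y \/ A c = y /\ B c = x ->
  (x = a \/ forall o, A o != B o -> A o != a /\ B o != a) ->
  let g := if (0 < gain A B x) (+) good x c then x else y in
  walk (assign A c g) (assign B c g) y.
Proof.
move=> W xy AB xa g.
have V z : - 1 - (z == x)%:R <= gain A B z <= 1 + (z == x)%:R.
  case: xa => [-> //|H]; have := walk_settled W H z.
  by case: (z == x) => /=; lia.
move=> z; have := V x; have := V z; rewrite eqxx /= /g => Vz Vx.
case: ifPn => Hg.
  rewrite (gain_resolve z xy AB) !(eq_sym _ z).
  move: Hg Vz Vx; have [->|_] := eqVneq z x.
    by rewrite (negPf xy) /=; case: (good x c); case: (ltrP 0 (gain A B x)) => //=; lia.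
  by case: (z == y); case: (good y c) => /=; lia.
have AB' : A c = y /\ B c = x \/ A c = x /\ B c = y by case: AB; [right|left].
rewrite (gain_resolve z _ AB') ?(eq_sym y) // !(eq_sym _ z).
move: Hg Vz Vx; have [->|_] := eqVneq z x.
  by rewrite (negPf xy) /=; case: (good x c); case: (ltrP 0 (gain A B x)) => //=; lia.
by case: (z == y); case: (good y c) => /=; lia.
Qed.

Lemma undecided_assign A B c g : A c != B c ->
  (undecided (assign A c g) (assign B c g) < undecided A B)%N.
Proof.
move=> AB; rewrite /undecided (bigD1 c) // [ltnRHS](bigD1 c) //= AB.
rewrite /assign eqxx eqxx /= add0n add1n ltnS.
by apply: eq_leq; apply: eq_bigr => o /negPf ->.
Qed.

(** The gain [2 * (share A x - q) - 1] is odd and lies in [-2, 2], hence is -1 or 1. *)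
Lemma walk_end A B a x :
  walk A B a -> (forall o, A o = B o) -> share A x = q \/ share A x = q + 1.
Proof. by move=> /(_ x) + AB; rewrite gain_decided //; case: (x == a) => /=; lia. Qed.

(** * Feasibility of the fractional solution and the bound on labels *)

Variable K : int.
Hypothesis total : forall a, \sum_o (if good a o then 1 else -1) = K.
Hypothesis n_gt0 : (0 < n)%N.
Hypotheses (q_le : n%:Z * q <= K) (K_le : K <= n%:Z * (q + 1)).

Lemma total_bounds : - m%:Z <= K <= m%:Z.
Proof.
rewrite -(total (Ordinal n_gt0)).
have -> : m%:Z = \sum_(o < m) 1 by rewrite sumr_const card_ord natz.
rewrite -sumrN; apply/andP; split; apply: ler_sum => o _; by case: ifP.
Qed.

Lemma offset_le p : offset p <= m%:Z.
Proof.
have n1 : 1 <= n%:Z by lia.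
have /andP[K1 K2] := total_bounds; rewrite /offset leNgt; case: p.2; apply/negP => H.
  have : 1 * (- q - 1) <= n%:Z * (- q - 1) by apply: ler_wpM2r => //; lia.
  rewrite mul1r (_ : n%:Z * _ = - (n%:Z * (q + 1))); [by lia|ring].
have : 1 * q <= n%:Z * q by apply: ler_wpM2r => //; lia.
by rewrite mul1r; lia.
Qed.

(** Each item contributes at most one unit and the offset at most [m]. This is why [potential] has
    the weight [2 * m + 1]. *)
Lemma load_le A B p : load A B p <= (2 * m)%:Z.
Proof.
rewrite mul2n -addnn PoszD; apply: lerD (offset_le p).
rewrite -[leRHS]natz -[m in leRHS]card_ord -sumr_const; apply: ler_sum => o _.
by do 2 case: eqP.
Qed.

(* No move takes a unit out of [R], so the load of [R] is at most the average over
   [b] of its load when all items are given to [b]; [R] will be the set of nodes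
   whose label exceeds an unused one. *)
Lemma cut_load A B (R : pred node) :
  (forall o b, R (loc (A o) o) -> R (loc b o)) ->
  (forall o b, R (opp (loc b o)) -> R (opp (loc (B o) o))) ->
  \sum_(p | R p) load A B p <= 0.
Proof.
move=> RA RB.
pose r o a : int := (R (loc a o))%:R; pose r' o a : int := (R (opp (loc a o)))%:R.
have delta (x : node) : \sum_(p | R p) (x == p)%:R = (R x)%:R :> int.
  have [Rx|Rx] := boolP (R x).
    rewrite (bigD1 x) //= eqxx big1 ?addr0 // => p /andP[_ /negPf].
    by rewrite eq_sym => ->.
  rewrite big1 // => p Rp; case: eqP => // E; by rewrite E Rp in Rx.
have sumE : \sum_(p | R p) load A B p
    = \sum_o (r o (A o) - r' o (B o)) + \sum_(p | R p) offset p.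
  rewrite /load big_split exchange_big /=; congr (_ + _).
  by apply: eq_bigr => o _; rewrite sumrB !delta.
have step : n%:Z * \sum_o (r o (A o) - r' o (B o))
    <= \sum_b \sum_o (r o b - r' o b).
  have -> : n%:Z * \sum_o (r o (A o) - r' o (B o))
    = \sum_(b < n) \sum_o (r o (A o) - r' o (B o)).
    by rewrite sumr_const card_ord -mulr_natl natz.
  apply: ler_sum => b _; apply: ler_sum => o _.
  have /implyP := @RA o b; have /implyP := @RB o b; rewrite /r /r'.
  by case: (R (loc (A o) o)); case: (R (opp (loc b o))); case: (R (loc b o));
    case: (R (opp (loc (B o) o))).
(* With both copies of every item given to [b], a liked item moves a unit from [(b, false)] to
   [(b, true)] and a disliked one moves it back, a net transfer of [K]. *)
have uni b : \sum_o (r o b - r' o b) = K * ((R (b, true))%:R - (R (b, false))%:R).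
  rewrite -(total b) mulr_suml; apply: eq_bigr => o _.
  by rewrite /r /r' /opp /loc /=; case: (good b o); rewrite /= ?mul1r //; ring.
have offE : \sum_(p | R p) offset p
    = \sum_b ((R (b, true))%:R * (- q - 1) + (R (b, false))%:R * q).
  rewrite big_mkcond (eq_bigr (fun p : node => (R (p.1, p.2))%:R * offset p)); last first.
    by case=> a s _ /=; case: (R _); rewrite ?mul1r ?mul0r.
  rewrite -(pair_bigA _ (fun a s => (R (a, s))%:R * offset (a, s))) /=.
  by apply: eq_bigr => b _; rewrite big_bool /=.
rewrite -(@pmulr_rle0 _ n%:Z) ?ltz_nat // sumE mulrDr.
rewrite (le_trans (lerD step (lexx _))) //.
rewrite (eq_bigr _ (fun b _ => uni b)) offE mulr_sumr -big_split /=.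
(* Agent [b] contributes [K - n * (q + 1)], [n * q - K], [- n] or 0 when [R] contains only
   [(b, true)], only [(b, false)], both or neither of its nodes. *)
apply: sumr_le0 => b _; move: q_le K_le; do 2 case: (R _) => /=; nia.
Qed.

Lemma label_bound A B h p :
  valid A B h -> (forall x, (0 < h x)%N -> 0 <= load A B x) ->
  0 < load A B p -> (h p < 2 * n)%N.
Proof.
move=> hV h0 lp; rewrite ltnNge; apply/negP => hp.
have [k kp kN] : exists2 k, (k < h p)%N & forall x, h x != k.
  have [k_in|] := boolP [exists k : 'I_(h p), [forall x, h x != k]].
    have /existsP[k /forallP kN] := k_in; by exists k.
  rewrite negb_exists => /forallP H.
  have : {subset iota 0 (h p).+1 <= map h (enum {: node})}.
    move=> k; rewrite mem_iota /= add0n ltnS leq_eqVlt => /orP[/eqP->|kp].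
      by apply: map_f; rewrite mem_enum.
    have := H (Ordinal kp); rewrite negb_forall => /existsP[x].
    by rewrite negbK => /eqP /= <-; apply: map_f; rewrite mem_enum.
  move/(uniq_leq_size (iota_uniq _ _)); rewrite size_iota size_map -cardE.
  rewrite card_prod card_ord card_bool; lia.
pose R x := (k < h x)%N.
have RA o b : R (loc (A o) o) -> R (loc b o).
  by rewrite /R; have [+ _] := hV o b; have := kN (loc b o); lia.
have RB o b : R (opp (loc b o)) -> R (opp (loc (B o) o)).
  by rewrite /R; have [_ +] := hV o b; have := kN (opp (loc (B o) o)); lia.
have := cut_load RA RB.
apply/negP; rewrite -ltNge (bigD1 p) //= ltr_pwDl // sumr_ge0 // => x /andP[kx _].
by apply: h0; move: kx; rewrite /R; lia.
Qed.

(** A stuck overloaded node is no higher than the nodes it could push to, so raising it by one keeps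
    validity. The strict inequality in [label_bound] leaves room for the new label. *)
Lemma labelled_relabel A B h :
  labelled A B h -> (forall o b, stuck A B h o b) ->
  labelled A B (relabel (load A B) h).
Proof.
move=> [hV h0 hb] S; rewrite /relabel; split=> [o b|x|x].
- have [V1 V2] := hV o b; have [S1 S2] := S o b.
  split; first by move: V1 S1; case: (0 < load A B (loc (A o) o)) => V1 S1; lia.
  by move: V2 S2; case: (0 < load A B (opp (loc b o))) => V2 S2; lia.
- have := h0 x; case: (ltrP 0 (load A B x)) => [/ltW //|_].
  by rewrite addn0.
- case: (ltrP 0 (load A B x)) => lx /=; last by rewrite addn0.
  by have := label_bound hV h0 lx; lia.
Qed.

Lemma potential_relabel A B h p :
  labelled A B h -> 0 < load A B p ->
  (potential (load A B) (relabel (load A B) h) < potential (load A B) h)%N.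
Proof.
move=> [hV h0 hb] lp; rewrite /potential (bigD1 p) // [ltnRHS](bigD1 p) //=.
have le x : ((2 * m).+1 * (2 * n - relabel (load A B) h x)
      + pos_part (load A B x) * relabel (load A B) h x + (0 < load A B x)%R
   <= (2 * m).+1 * (2 * n - h x) + pos_part (load A B x) * h x)%N.
  rewrite /relabel; case: (ltrP 0 (load A B x)) => lx /=; last by rewrite !addn0.
  have hx := label_bound hV h0 lx; have := load_le A B x.
  move: lx; case: (load A B x) => // k _; rewrite lez_nat /pos_part; nia.
have lep := le p; rewrite lp /= in lep.
rewrite -addSn; apply: leq_add; first by lia.
by apply: leq_sum => x _; have := le x; lia.
Qed.

End Balancing.

(** * The push-relabel program *)

(* Items are numbered from 1, as are agents, and node (i, s) has number i or -i.
   [arr_A] and [arr_B] map items to the owners of their copies.  Entry i of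
   [arr_row] is the index preceding the values of agent i in the input array;
   [arr_loc], with the same layout, has the number of the node [loc i o]. *)
Local Notation arr_A := 2%N.
Local Notation arr_B := 3%N.
Local Notation arr_load := 4%N.
Local Notation arr_label := 5%N.
Local Notation arr_loc := 6%N.
Local Notation arr_row := 7%N.
Local Notation var_o := 8%N.
Local Notation var_b := 9%N.
Local Notation var_k := 10%N.
Local Notation var_q := 11%N.
Local Notation var_K := 12%N.
Local Notation var_r := 13%N.
Local Notation var_x := 14%N.
Local Notation var_y := 15%N.
Local Notation var_a := 16%N.
Local Notation var_c := 17%N.

Local Notation "p ;; q" := (Seq p q) (at level 90, right associativity).
Local Notation num_agents := (Get 0 (Const 1)).
Local Notation num_items := (Get 0 (Const 2)).
Local Notation Entry k a o := (Get k (Plus (Get arr_row a) o)).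
Local Notation Opp e := (Minus (Const 0) e).

(** The flag [var_k] records that something has changed. *)
Definition push (k : nat) : cmd :=
  If (Get arr_load (Var var_x))
    (If (Minus (Get arr_label (Var var_x)) (Get arr_label (Var var_y)))
       (Put k (Var var_o) (Var var_b) ;;
        Put arr_load (Var var_x) (Minus (Get arr_load (Var var_x)) (Const 1)) ;;
        Put arr_load (Var var_y) (Plus (Get arr_load (Var var_y)) (Const 1)) ;;
        Set_ var_k (Const 1))
       Skip)
    Skip.

Definition push_both : cmd :=
  Set_ var_x (Entry arr_loc (Get arr_A (Var var_o)) (Var var_o)) ;;
  Set_ var_y (Entry arr_loc (Var var_b) (Var var_o)) ;;
  push arr_A ;;
  Set_ var_x (Opp (Entry arr_loc (Var var_b) (Var var_o))) ;;
  Set_ var_y (Opp (Entry arr_loc (Get arr_B (Var var_o)) (Var var_o))) ;;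
  push arr_B.

Definition raise (e : expr) : cmd :=
  If (Get arr_load e)
    (Put arr_label e (Plus (Get arr_label e) (Const 1)) ;; Set_ var_k (Const 1))
    Skip.

Definition sweep : cmd := For var_o num_items (For var_b num_agents push_both).

Definition relabel_all : cmd :=
  For var_b num_agents (raise (Var var_b) ;; raise (Opp (Var var_b))).

(** Labels are raised only after a sweep without pushes, when every overloaded node is stuck as
    [labelled_relabel] requires. The loop stops when nothing is pushed or raised. *)
Definition balance : cmd :=
  For var_b num_agents
    (Put arr_label (Var var_b) (Const 0) ;; Put arr_label (Opp (Var var_b)) (Const 0)) ;;
  Set_ var_k (Const 1) ;;
  While (Var var_k)
    (Set_ var_k (Const 0) ;; sweep ;; If (Var var_k) Skip relabel_all).

Lemma updateE s a x z y : update s a x z a y = if y == x then z else s a y.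
Proof. by rewrite /update eqxx. Qed.

(** * Correctness of the push-relabel program *)

Section Balancing.

Variables (n m : nat) (good : 'I_n -> 'I_m -> bool) (q : int).
Local Notation node := ('I_n * bool)%type.
Implicit Types (A B : 'I_m -> 'I_n) (l : node -> int) (h : node -> nat).
Local Notation load := (load good q).
Local Notation loc := (loc good).

Definition code (p : node) : int := if p.2 then p.1.+1%:Z else - p.1.+1%:Z.

Lemma code_opp p : code (opp p) = - code p.
Proof. by rewrite /code /=; case: p.2; rewrite //= opprK. Qed.

Lemma code_inj : injective code.
Proof.
move=> [a s] [b t]; rewrite /code /=.
by case: s; case: t => E; congr (_, _); try apply: val_inj => /=; lia.
Qed.

Lemma code_eq p p' : (code p == code p') = (p == p').
Proof. exact: inj_eq code_inj _ _. Qed.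

(** In the input array, the length and the two dimensions occupy cells 0 to 2; hence the values of
    the agent with ordinal [a] follow index [2 + a * m]. *)
Definition tables (s : store) : Prop :=
  [/\ s 0%N 1 = n%:Z, s 0%N 2 = m%:Z,
      forall a : 'I_n, s arr_row a.+1%:Z = (2 + a * m)%N%:Z,
      forall (a : 'I_n) (o : 'I_m), s 0%N ((2 + a * m)%N%:Z + o.+1%:Z) = (if good a o then 1 else -1)
    & forall (a : 'I_n) (o : 'I_m), s arr_loc ((2 + a * m)%N%:Z + o.+1%:Z) = code (loc a o)].

Definition owners k A (s : store) : Prop := forall o : 'I_m, s k o.+1%:Z = (A o).+1%:Z.
Definition loads l (s : store) : Prop := forall p, s arr_load (code p) = l p.
Definition labels h (s : store) : Prop := forall p, s arr_label (code p) = (h p)%:Z.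

Lemma owners_update k A s (o : 'I_m) (b : 'I_n) :
  owners k A s -> owners k (assign A o b) (update s k o.+1%:Z b.+1%:Z).
Proof.
move=> H j; rewrite updateE /assign eqz_nat eqSS.
by rewrite -(inj_eq val_inj) /=; case: ifP.
Qed.

Lemma loads_update l s p z :
  loads l s -> loads (assign l p z) (update s arr_load (code p) z).
Proof. by move=> H x; rewrite updateE code_eq /assign; case: ifP. Qed.

Lemma labels_update h s p k z : z = k%:Z ->
  labels h s -> labels (assign h p k) (update s arr_label (code p) z).
Proof. by move=> -> H x; rewrite updateE code_eq /assign; case: ifP. Qed.

Definition state A B h (s : store) : Prop :=
  [/\ tables s, owners arr_A A s, owners arr_B B s, loads (load A B) s & labels h s].

Definition pushed A B h A' B' : Prop :=
  [/\ labelled good q A' B' h,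
      (potential m (load A' B') h < potential m (load A B) h)%N
    & (forall p, -1 <= load A B p) -> forall p, -1 <= load A' B' p].

Lemma loads_push l s x y : x != y -> loads l s ->
  loads (fun p => l p - (x == p)%:R + (y == p)%:R)
    (update (update s arr_load (code x) (l x - 1)) arr_load (code y) (l y + 1)).
Proof.
move=> xy H p; rewrite !updateE !code_eq !(eq_sym _ p).
have [->|_] := eqVneq p y; first by rewrite eq_sym (negPf xy) subr0.
by have [->|_] := eqVneq p x; rewrite ?addr0 ?subr0 ?H.
Qed.

Variable bd : nat.

Lemma wp_push k s l h x y (Q : store -> Prop) :
  (k < arr_load)%N -> loads l s -> labels h s ->
  s var_x 0 = code x -> s var_y 0 = code y ->
  (0 < l x -> (h y < h x)%N ->
   Q (update (update (update (update s k (s var_o 0) (s var_b 0))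
        arr_load (code x) (l x - 1)) arr_load (code y) (l y + 1)) var_k 0 1)) ->
  ((0 < l x -> (h x <= h y)%N) -> Q s) ->
  wp bd (push k) s Q.
Proof.
move=> k4 Hl Hh xE yE Qpush Qstuck /=; rewrite xE yE Hl !Hh.
case: ifP => [lx|/negbT lx]; last by apply: Qstuck => H; rewrite H in lx.
case: ifP => hxy; last by apply: Qstuck => _; lia.
have {}hxy : (h y < h x)%N by lia.
have xy : y != x by apply: contraTneq hxy => ->; rewrite ltnn.
have := Qpush lx hxy; set t := update s k _ _ => Qt.
have tE b z : (arr_load <= b)%N -> t b z = s b z.
  by move=> kb; rewrite /t /update gtn_eqF //; apply: leq_trans kb.
have -> : t var_x 0 = code x by rewrite tE.
set t2 := update t _ _ _.
have -> : t2 var_y 0 = code y by rewrite -yE -tE.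
by rewrite {2}/t2 updateE code_eq (negPf xy) /t2 !tE // !Hl.
Qed.

Lemma wp_push_left A B h (o : 'I_m) (b : 'I_n) s :
  state A B h s -> labelled good q A B h ->
  s var_o 0 = o.+1%:Z -> s var_b 0 = b.+1%:Z ->
  s var_x 0 = code (loc (A o) o) -> s var_y 0 = code (loc b o) ->
  wp bd (push arr_A) s (fun s' => exists A',
    [/\ state A' B h s', s' var_o 0 = o.+1%:Z, s' var_b 0 = b.+1%:Z &
        [/\ A' = A, s' var_k 0 = s var_k 0
          & 0 < load A B (loc (A o) o) -> (h (loc (A o) o) <= h (loc b o))%N] \/
        (s' var_k 0 = 1 /\ pushed A B h A' B)]).
Proof.
move=> [St SA SB Sl Sh] L oE bE xE yE.
apply: (wp_push _ Sl Sh xE yE) => // [lx hyx|stk]; last by exists A; split=> //; left.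
have xy : loc (A o) o != loc b o by apply: contraTneq hyx => ->; rewrite ltnn.
exists (assign A o b); rewrite oE bE; split=> //.
  split=> //; first exact: owners_update.
  move=> p; rewrite load_assignl //.
  exact: (loads_push xy (s := update s arr_A o.+1 b.+1)).
by right; split=> //; exact: push_left.
Qed.

Lemma wp_push_right A B h (o : 'I_m) (b : 'I_n) s :
  state A B h s -> labelled good q A B h ->
  s var_o 0 = o.+1%:Z -> s var_b 0 = b.+1%:Z ->
  s var_x 0 = code (opp (loc b o)) -> s var_y 0 = code (opp (loc (B o) o)) ->
  wp bd (push arr_B) s (fun s' => exists B',
    [/\ state A B' h s', s' var_o 0 = o.+1%:Z, s' var_b 0 = b.+1%:Z &
        [/\ B' = B, s' var_k 0 = s var_k 0
          & 0 < load A B (opp (loc b o)) ->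
            (h (opp (loc b o)) <= h (opp (loc (B o) o)))%N] \/
        (s' var_k 0 = 1 /\ pushed A B h A B')]).
Proof.
move=> [St SA SB Sl Sh] L oE bE xE yE.
apply: (wp_push _ Sl Sh xE yE) => // [lx hyx|stk]; last by exists B; split=> //; left.
have xy : opp (loc b o) != opp (loc (B o) o) by apply: contraTneq hyx => ->; rewrite ltnn.
exists (assign B o b); rewrite oE bE; split=> //.
  split=> //; first exact: owners_update.
  move=> p; rewrite load_assignr //.
  exact: (loads_push xy (s := update s arr_B o.+1 b.+1)).
by right; split=> //; exact: push_right.
Qed.

Lemma wp_push_both A B h (o : 'I_m) (b : 'I_n) s :
  state A B h s -> labelled good q A B h ->
  s var_o 0 = o.+1%:Z -> s var_b 0 = b.+1%:Z ->
  wp bd push_both s (fun s' => exists A' B',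
    [/\ state A' B' h s', s' var_o 0 = o.+1%:Z, s' var_b 0 = b.+1%:Z &
        [/\ A' = A, B' = B, s' var_k 0 = s var_k 0 & stuck good q A B h o b] \/
        (s' var_k 0 = 1 /\ pushed A B h A' B')]).
Proof.
move=> S L oE bE.
have [[tn tm tR tv tT] SA SB Sl Sh] := S.
have x1 : eval s (Entry arr_loc (Get arr_A (Var var_o)) (Var var_o)) = code (loc (A o) o).
  by rewrite /= oE SA tR tT.
rewrite /push_both wp_seq wp_put x1.
set s1 := update s _ _ _.
have y1 : eval s1 (Entry arr_loc (Var var_b) (Var var_o)) = code (loc b o).
  by rewrite -[LHS]/(eval s (Entry arr_loc (Var var_b) (Var var_o))) /= oE bE tR tT.
rewrite wp_seq wp_put y1 wp_seq.
set s2 := update s1 _ _ _.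
have S2 : state A B h s2 by [].
apply: wp_mono (wp_push_left S2 L oE bE (erefl _) (erefl _)).
move=> s3 [A' [S3 o3 b3 H3]].
have [[tn' tm' tR' tv' tT'] SA' SB' Sl' Sh'] := S3.
have L' : labelled good q A' B h by case: H3 => [[-> _ _]|[_ [? _ _]]].
have x4 : eval s3 (Opp (Entry arr_loc (Var var_b) (Var var_o))) = code (opp (loc b o)).
  by rewrite /= o3 b3 tR' tT' code_opp sub0r.
rewrite wp_seq wp_put x4.
set s4 := update s3 _ _ _.
have y4 : eval s4 (Opp (Entry arr_loc (Get arr_B (Var var_o)) (Var var_o)))
    = code (opp (loc (B o) o)).
  rewrite -[LHS]/(eval s3 (Opp (Entry arr_loc (Get arr_B (Var var_o)) (Var var_o)))).
  by rewrite /= o3 SB' tR' tT' code_opp sub0r.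
rewrite wp_seq wp_put y4.
set s5 := update s4 _ _ _.
have S5 : state A' B h s5 by [].
apply: wp_mono (wp_push_right S5 L' o3 b3 (erefl _) (erefl _)).
move=> s6 [B' [S6 o6 b6 H6]]; exists A', B'; split=> //.
case: H3 => [[EA k3 stk]|[k3 [_ P3 low3]]]; case: H6 => [[EB k6 stk']|[k6 [L6 P6 low6]]].
- by subst A' B'; left; split=> //; rewrite k6.
- by subst A'; right.
- by subst B'; right; rewrite k6; split=> //; split.
- right; split=> //; split=> //; first exact: ltn_trans P3.
  by move=> /low3 /low6.
Qed.

(** Stuckness of the visited pairs [P] is recorded only while nothing has been pushed, since a push
    may unblock earlier pairs; after a push, the drop of the potential is all that is needed. *)
Definition swept A B h (P : nat -> nat -> Prop) (s : store) : Prop :=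
  exists A' B', state A' B' h s /\
    ([/\ A' = A, B' = B, s var_k 0 = 0
       & forall (o : 'I_m) (b : 'I_n), P o b -> stuck good q A B h o b] \/
     (s var_k 0 = 1 /\ pushed A B h A' B')).

Lemma swept_step A B h (P P' : nat -> nat -> Prop) (o : 'I_m) (b : 'I_n) s :
  labelled good q A B h -> swept A B h P s ->
  s var_o 0 = o.+1%:Z -> s var_b 0 = b.+1%:Z ->
  (forall o' b', P' o' b' -> P o' b' \/ o' = o /\ b' = b) ->
  wp bd push_both s (fun s' =>
    [/\ swept A B h P' s', s' var_o 0 = o.+1%:Z & s' var_b 0 = b.+1%:Z]).
Proof.
move=> L [A1 [B1 [S1 H1]]] oE bE PP'.
have L1 : labelled good q A1 B1 h by case: H1 => [[-> -> _ _]|[_ []]].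
apply: wp_mono (wp_push_both S1 L1 oE bE) => s2 [A2 [B2 [S2 o2 b2 H2]]].
split=> //; exists A2, B2; split=> //.
case: H1 => [[EA EB k1 stk]|[k1 [_ P1 low1]]]; last first.
  right; case: H2 => [[-> -> k2 _]|[k2 [L2 P2 low2]]]; rewrite k2; first by split.
  split=> //; split=> //; first exact: ltn_trans P1.
  by move=> /low1 /low2.
subst A1 B1; case: H2 => [[-> -> k2 stk2]|[k2 P2]]; last by right.
left; split=> // [|o' b' /PP' [/stk //|[/val_inj -> /val_inj -> //]]].
by rewrite k2.
Qed.

Hypotheses (n_bd : (n <= bd)%N) (m_bd : (m <= bd)%N).

Lemma wp_sweep A B h s :
  state A B h s -> labelled good q A B h -> s var_k 0 = 0 ->
  wp bd sweep s (swept A B h (fun _ _ => True)).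
Proof.
move=> S L k0; rewrite /sweep.
apply: (wp_for (N := m) (I := fun j s => swept A B h (fun o _ => o < j)%N s)) => //.
- by exists A, B; split=> //; left.
- by move=> j s1 [A1 [B1 [[[]] ]]].
- move=> j s1 jm I1 oE.
  apply: (wp_for (N := n) (I := fun i s =>
    swept A B h (fun o b => o < j \/ o = j /\ b < i)%N s /\ s var_o 0 = j.+1%:Z)) => //.
  + split=> //; have [A1 [B1 [S1 H1]]] := I1; exists A1, B1; split=> //.
    case: H1 => [[? ? ? stk]|]; [left|by right].
    by split=> // o b [|[_ //]]; apply: stk.
  + by move=> i s2 [[A1 [B1 [[[]]]]]].
  + move=> i s2 iltn [I2 oE2] bE2.
    apply: wp_mono (@swept_step _ _ _ _
      (fun o b => o < j \/ o = j /\ b < i.+1)%N (Ordinal jm) (Ordinal iltn) _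
      L I2 oE2 bE2 _) => [s3 []//|o b /=].
    case=> [?|[-> ]]; first by left; left.
    by rewrite ltnS leq_eqVlt => /orP[/eqP ->|?]; [right|left; right].
  + move=> s2 [[A1 [B1 [S1 H1]]] oE2]; split=> //; exists A1, B1; split=> //.
    case: H1 => [[? ? ? stk]|]; [left|by right].
    split=> // o b; rewrite ltnS leq_eqVlt => /orP[/eqP Eo|?]; apply: stk; last by left.
    by right.
- move=> s1 [A1 [B1 [S1 H1]]]; exists A1, B1; split=> //.
  by case: H1 => [[? ? ? stk]|]; [left; split=> // o b _; apply: stk|right].
Qed.

Lemma wp_raise A B h h1 (p : node) e s (Q : store -> Prop) :
  state A B h1 s -> eval s e = code p -> h1 p = h p ->
  (forall s', state A B (assign h1 p (relabel (load A B) h p)) s' ->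
     s' var_b 0 = s var_b 0 ->
     s' var_k 0 = (if 0 < load A B p then 1 else s var_k 0) -> Q s') ->
  wp bd (raise e) s Q.
Proof.
move=> [St SA SB Sl Sh] eE h1p HQ; rewrite /raise wp_if.
have -> : eval s (Get arr_load e) = load A B p by rewrite /= eE Sl.
have := HQ; rewrite /relabel; case: (ltrP 0 (load A B p)) => lp {}HQ.
  rewrite wp_seq !wp_put eE.
  have -> : eval s (Plus (Get arr_label e) (Const 1)) = (h p + 1)%N%:Z.
    by rewrite /= eE Sh h1p PoszD.
  apply: HQ => //; split=> //.
  exact: (labels_update _ _ Sh).
apply: HQ => //; split=> // x; rewrite Sh addn0 -h1p /assign.
by case: eqP => // ->.
Qed.

Lemma wp_relabel_all A B h s :
  state A B h s -> s var_k 0 = 0 ->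
  wp bd relabel_all s (fun s' => state A B (relabel (load A B) h) s' /\
    ((forall p, load A B p <= 0) /\ s' var_k 0 = 0 \/
     (exists p, 0 < load A B p) /\ s' var_k 0 = 1)).
Proof.
move=> S k0; pose l := load A B.
(* Raising a label does not change any load, so relabelling node by node amounts to a simultaneous
   [relabel]; [P] is the set of nodes already treated. *)
pose I (P : pred node) s := state A B (fun p => if P p then relabel l h p else h p) s /\
    ((forall p, P p -> l p <= 0) /\ s var_k 0 = 0 \/ (exists p, 0 < l p) /\ s var_k 0 = 1).
have eqI (P P' : pred node) s1 : P =1 P' -> I P s1 -> I P' s1.
  move=> E [[St SA SB Sl Sh] H]; split; first by split=> // x; rewrite -E; apply: Sh.
  by case: H => [[H H']|]; [left; split=> // p; rewrite -E; apply: H|right].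
have stepI (P : pred node) p e s1 : ~~ P p -> I P s1 -> eval s1 e = code p ->
    wp bd (raise e) s1 (fun s' => I (predU1 p P) s' /\ s' var_b 0 = s1 var_b 0).
  move=> Pp [S1 H1] eE; apply: (wp_raise (h := h) S1 eE); rewrite ?(negPf Pp) // => s2 S2 b2 k2.
  split=> //; split.
    have [St SA SB Sl Sh] := S2; split=> // x; rewrite Sh /assign /=.
    by case: eqP => // ->.
  rewrite k2; case: ltrP => lp; first by right; split=> //; exists p.
  case: H1 => [[H1 k1]|]; [left; split=> // x /orP[/eqP -> //|]; exact: H1|by right].
rewrite /relabel_all.
apply: (wp_for (N := n) (I := fun j s => I (fun p => p.1 < j)%N s)) => //.
- by split=> //; left.
- by move=> j s1 [[[]]].
- move=> j s1 jn I1 b1; pose b := Ordinal jn; rewrite wp_seq.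
  have N1 : ~~ ((b, true).1 < j)%N by rewrite /= ltnn.
  apply: wp_mono (stepI _ (b, true) (Var var_b) s1 N1 I1 _) => //.
  move=> s2 [I2 b2].
  have N2 : ~~ predU1 (b, true) (fun p : node => p.1 < j)%N (b, false).
    by rewrite /= xpair_eqE andbF ltnn.
  apply: wp_mono (stepI _ (b, false) _ s2 N2 I2 _); last first.
    by rewrite /= b2 b1 /code /= sub0r.
  move=> s3 [I3 b3]; split; last by rewrite b3 b2.
  apply: eqI I3 => -[a t] /=; rewrite !xpair_eqE ltnS (leq_eqVlt a).
  by rewrite -(inj_eq val_inj) /=; case: t; case: (_ == j).
- move=> s1 [[St SA SB Sl Sh] H]; split.
    by split=> // p; rewrite Sh ltn_ord.
  by case: H => [[H k1]|]; [left; split=> // p; apply: H|right].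
Qed.

Variable K : int.
Hypothesis total : forall a, \sum_o (if good a o then 1 else -1) = K.
Hypothesis n_gt0 : (0 < n)%N.
Hypotheses (q_le : n%:Z * q <= K) (K_le : K <= n%:Z * (q + 1)).
Hypothesis potential_bd : (2 * n * ((2 * m).+1 * (2 * n)) < bd)%N.

Lemma wp_balance A B h s :
  state A B h s ->
  wp bd balance s (fun s' => exists A' B' h', [/\ state A' B' h' s',
     forall p, load A' B' p <= 0 &
     (forall p, -1 <= load A B p) -> forall p, -1 <= load A' B' p]).
Proof.
move=> S; pose low A' B' := (forall p, -1 <= load A B p) -> forall p, -1 <= load A' B' p.
rewrite /balance wp_seq.
apply: (wp_for (N := n) (I := fun j s =>
  state A B (fun p => if (p.1 < j)%N then 0%N else h p) s)) => //.
- by move=> j s1 [[]].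
- move=> j s1 jn [St SA SB Sl Sh] b1; pose b := Ordinal jn.
  rewrite wp_seq !wp_put (_ : eval s1 (Var var_b) = code (b, true)) //.
  set s2 := update s1 _ _ _.
  have -> : eval s2 (Opp (Var var_b)) = code (b, false).
    by rewrite -[LHS]/(0 - s1 var_b 0) b1 sub0r.
  split=> //; split=> //.
  have H1 := @labels_update _ _ (b, true) 0 0 (erefl _) Sh.
  have H2 := @labels_update _ _ (b, false) 0 0 (erefl _) H1.
  move=> p; rewrite -[RHS]/((if (p.1 < j.+1)%N then 0%N else h p)%:Z).
  have -> : (if (p.1 < j.+1)%N then 0%N else h p)
      = assign (assign (fun p : node => if (p.1 < j)%N then 0%N else h p) (b, true) 0%N) (b, false) 0%N p.
    rewrite /assign; case: p => a t; rewrite !xpair_eqE ltnS (leq_eqVlt a).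
    by rewrite -(inj_eq val_inj) /=; case: t; case: (_ == j).
  by rewrite -H2.
move=> s1 S1; rewrite wp_seq wp_put.
(* The measure exceeds the potential while the flag is set. Once the flag is cleared it is
   unconstrained, so the last pass, which changes nothing, can bring it to 0. *)
pose M (k : nat) s := exists A' B' h', [/\ state A' B' h' s, labelled good q A' B' h', low A' B',
    s var_k 0 = 1 -> (potential m (load A' B') h' < k)%N
  & s var_k 0 = 1 \/ s var_k 0 = 0 /\ forall p, load A' B' p <= 0].
apply: (@wp_while _ _ _ M _ _ _ potential_bd) => //.
- exists A, B, (fun=> 0%N); split=> //.
  + have [St SA SB Sl Sh] := S1; split=> // p.
    by have := Sh p; rewrite ltn_ord.
  + by move=> _; rewrite potential0.
  + by left.
- move=> k s2 [A2 [B2 [h2 [S2 L2 low2 k2 H2]]]] k_gt0.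
  have {}H2 : s2 var_k 0 = 1 by case: H2 => // -[E]; move: k_gt0; rewrite /= E.
  have {}k2 := k2 H2.
  rewrite wp_seq wp_put wp_seq.
  apply: wp_mono (wp_sweep _ L2 (erefl _)); last by case: S2.
  move=> s3 [A3 [B3 [S3 H3]]]; rewrite wp_if.
  case: H3 => [[EA EB k3 stk]|[k3 [L3 P3 low3]]]; last first.
    rewrite (_ : eval s3 (Var var_k) = 1) //=; exists k.-1; first by lia.
    exists A3, B3, h2; split=> //; [by move=> /low2|by lia|by left].
  rewrite (_ : eval s3 (Var var_k) = 0) //=; subst A3 B3.
  apply: wp_mono (wp_relabel_all S3 k3) => s4 [S4 H4].
  have L4 := labelled_relabel total n_gt0 q_le K_le L2 (fun o b => stk o b I).
  case: H4 => [[l0 k4]|[[p lp] k4]].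
    exists 0%N; first by lia.
    exists A2, B2, (relabel (load A2 B2) h2); split=> //; first by rewrite k4.
    by right.
  have := potential_relabel total n_gt0 q_le K_le L2 lp => P4.
  exists k.-1; first by lia.
  exists A2, B2, (relabel (load A2 B2) h2); split=> //; [by lia|by left].
- move=> k s2 [A2 [B2 [h2 [S2 L2 low2 k2 H2]]]] k0.
  exists A2, B2, h2; split=> //.
  by case: H2 => [E|[]//]; move: k0; rewrite /= E.
Qed.

End Balancing.

(** * The other parts of the program *)

Definition IfEq (e1 e2 : expr) (p q : cmd) : cmd :=
  If (Minus e1 e2) q (If (Minus e2 e1) q p).

Lemma wp_ifeq B e1 e2 p q s Q :
  wp B (IfEq e1 e2 p q) s Q =
  if eval s e1 == eval s e2 then wp B p s Q else wp B q s Q.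
Proof. by rewrite /IfEq !wp_if /= !subr_gt0; case: ltrgtP. Qed.

(** Rounding [K / n] goes by repeated subtraction: from remainder [K + n * m] and quotient [- m],
    units of [n] are removed until the remainder is at most [n]. Both copies of all items go to the
    first agent. *)
Definition setup : cmd :=
  For var_o num_items
    (Set_ var_K (Plus (Var var_K) (Get 0 (Plus (Const 2) (Var var_o))))) ;;
  Set_ var_r (Var var_K) ;; Set_ var_q (Opp num_items) ;;
  Put arr_row (Const 1) (Const 2) ;;
  For var_b num_agents
    (For var_o num_items
       (If (Entry 0 (Var var_b) (Var var_o))
          (Put arr_loc (Plus (Get arr_row (Var var_b)) (Var var_o)) (Var var_b))
          (Put arr_loc (Plus (Get arr_row (Var var_b)) (Var var_o)) (Opp (Var var_b)))) ;;
     Put arr_row (Plus (Var var_b) (Const 1)) (Plus (Get arr_row (Var var_b)) num_items) ;;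
     Set_ var_r (Plus (Var var_r) num_items)) ;;
  While (Minus (Var var_r) num_agents)
    (Set_ var_r (Minus (Var var_r) num_agents) ;;
     Set_ var_q (Plus (Var var_q) (Const 1))) ;;
  For var_b num_agents
    (Put arr_load (Var var_b) (Minus (Const (-1)) (Var var_q)) ;;
     Put arr_load (Opp (Var var_b)) (Var var_q)) ;;
  Put arr_load (Const 1) (Plus (Get arr_load (Const 1)) (Var var_K)) ;;
  Put arr_load (Const (-1)) (Minus (Get arr_load (Const (-1))) (Var var_K)) ;;
  For var_o num_items
    (Put arr_A (Var var_o) (Const 1) ;; Put arr_B (Var var_o) (Const 1)).

Definition swap : cmd :=
  For var_b num_agents
    (Set_ var_x (Get arr_load (Var var_b)) ;;
     Put arr_load (Var var_b) (Minus (Const (-1)) (Get arr_load (Opp (Var var_b)))) ;;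
     Put arr_load (Opp (Var var_b)) (Minus (Const (-1)) (Var var_x))) ;;
  For var_o num_items
    (Set_ var_x (Get arr_A (Var var_o)) ;;
     Put arr_A (Var var_o) (Get arr_B (Var var_o)) ;;
     Put arr_B (Var var_o) (Var var_x)).

(** The first undecided item serves as a fallback, overwritten by any later undecided item that the
    current agent owns; [var_c] stays 0 if all are decided. *)
Definition select : cmd :=
  For var_o num_items
    (IfEq (Get arr_A (Var var_o)) (Get arr_B (Var var_o)) Skip
       (If (Var var_c)
          (IfEq (Get arr_A (Var var_o)) (Var var_a) (Set_ var_c (Var var_o))
             (IfEq (Get arr_B (Var var_o)) (Var var_a) (Set_ var_c (Var var_o)) Skip))
          (Set_ var_c (Var var_o)))).

Definition exchange : cmd :=
  Set_ var_r (Var var_x) ;; Set_ var_x (Var var_y) ;; Set_ var_y (Var var_r).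

(** The first exchange makes [var_x] the current agent if it owns a copy of the item. The walk moves
    on to [var_y] before the two variables are turned into winner and loser. *)
Definition resolve : cmd :=
  Set_ var_x (Get arr_A (Var var_c)) ;; Set_ var_y (Get arr_B (Var var_c)) ;;
  IfEq (Var var_y) (Var var_a) exchange Skip ;;
  Set_ var_a (Var var_y) ;;
  If (Get arr_load (Var var_x))
    (If (Entry 0 (Var var_x) (Var var_c)) exchange Skip)
    (If (Entry 0 (Var var_x) (Var var_c)) Skip exchange) ;;
  Put arr_A (Var var_c) (Var var_x) ;; Put arr_B (Var var_c) (Var var_x) ;;
  Put arr_load (Var var_x)
    (Plus (Get arr_load (Var var_x)) (Entry 0 (Var var_x) (Var var_c))) ;;
  Put arr_load (Var var_y)
    (Minus (Get arr_load (Var var_y)) (Entry 0 (Var var_y) (Var var_c))).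

Definition merge : cmd :=
  For var_b num_agents
    (Put arr_load (Var var_b)
       (Minus (Get arr_load (Var var_b)) (Get arr_load (Opp (Var var_b))))) ;;
  Set_ var_a (Const 1) ;; Set_ var_c (Const 1) ;;
  While (Var var_c) (Set_ var_c (Const 0) ;; select ;; If (Var var_c) resolve Skip).

Definition output : cmd :=
  Put 1 (Const 0) num_items ;;
  For var_o num_items (Put 1 (Var var_o) (Minus (Get arr_A (Var var_o)) (Const 1))).

(** Without items the output array, initially zero, already holds the empty word. *)
Definition allocate : cmd :=
  If num_items (setup ;; balance ;; swap ;; balance ;; merge ;; output) Skip.

(** * Correctness of the other parts of the program *)

Section Program.

Variables (n m : nat) (good : 'I_n -> 'I_m -> bool).

Local Notation node := ('I_n * bool)%type.
Implicit Types (A B : 'I_m -> 'I_n) (l : node -> int) (h : node -> nat).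
Local Notation load := (load good).
Local Notation loc := (loc good).
Local Notation state := (state good).
Local Notation tables := (tables good).
Local Notation gain := (gain good).

Variable (bd : nat).
Hypotheses (n_bd : (n <= bd)%N) (m_bd : (m <= bd)%N).

Lemma wp_swap q A B h s :
  state q A B h s -> wp bd swap s (fun s' => state q B A h s').
Proof.
move=> S; rewrite /swap wp_seq.
(* Each new load is computed from the old load of the opposite node, so the two nodes of an agent
   are rewritten in the same pass. *)
apply: (wp_for (N := n) (I := fun j s =>
  [/\ tables s, owners arr_A A s, owners arr_B B s, labels h s
    & loads (fun p : node => if (p.1 < j)%N then -1 - load q A B (opp p)
                             else load q A B p) s])) => //.
- by case: S.
- by move=> j s1 [[]].
- move=> j s1 jn [St SA SB Sh Sl] b1; pose b := Ordinal jn.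
  have lt : s1 arr_load (code (b, true)) = load q A B (b, true) by rewrite Sl /= ltnn.
  have lf : s1 arr_load (code (b, false)) = load q A B (b, false) by rewrite Sl /= ltnn.
  rewrite !(wp_seq, wp_put).
  have -> : eval s1 (Get arr_load (Var var_b)) = load q A B (b, true) by rewrite /= b1 -lt.
  set s2 := update s1 _ _ _.
  have -> : eval s2 (Var var_b) = code (b, true) by [].
  have -> : eval s2 (Minus (Const (-1)) (Get arr_load (Opp (Var var_b))))
      = -1 - load q A B (b, false).
    rewrite -[LHS]/(-1 - s1 arr_load (0 - s1 var_b 0)) b1 sub0r.
    by rewrite -lf.
  set s3 := update s2 _ _ _.
  have -> : eval s3 (Opp (Var var_b)) = code (b, false).
    by rewrite -[LHS]/(0 - s1 var_b 0) b1 sub0r.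
  have -> : eval s3 (Minus (Const (-1)) (Var var_x)) = -1 - load q A B (b, true) by [].
  split=> //; split=> //.
  have Sl2 : loads _ s2 := Sl.
  have H1 := loads_update (b, true) (-1 - load q A B (b, false)) Sl2.
  have H2 := loads_update (b, false) (-1 - load q A B (b, true)) H1.
  move=> p; rewrite H2 /assign; case: p => a t.
  rewrite !xpair_eqE ltnS (leq_eqVlt a) -(inj_eq val_inj) /=.
  case: eqP => [E|_] /=; last by case: t.
  have -> : a = b by apply: val_inj.
  by case: t.
move=> s1 [St SA SB Sh Sl].
have {}Sl : loads (load q B A) s1 by move=> p; rewrite Sl ltn_ord -load_swap.
apply: (wp_for (N := m) (I := fun j s =>
  [/\ tables s, labels h s, loads (load q B A) s
    & owners arr_A (fun o : 'I_m => if (o < j)%N then B o else A o) s /\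
      owners arr_B (fun o : 'I_m => if (o < j)%N then A o else B o) s])) => //.
- by move=> j s2 [[]].
- move=> j s2 jm [St2 Sh2 Sl2 [SA2 SB2]] o2; pose o := Ordinal jm.
  have a2 : s2 arr_A o.+1%:Z = (A o).+1 by rewrite SA2 ltnn.
  have b2 : s2 arr_B o.+1%:Z = (B o).+1 by rewrite SB2 ltnn.
  rewrite !(wp_seq, wp_put).
  have -> : eval s2 (Get arr_A (Var var_o)) = (A o).+1 by rewrite /= o2 a2.
  set s3 := update s2 _ _ _.
  have -> : eval s3 (Var var_o) = o.+1 by [].
  have -> : eval s3 (Get arr_B (Var var_o)) = (B o).+1.
    by rewrite -[LHS]/(s2 arr_B (s2 var_o 0)) o2 b2.
  set s4 := update s3 _ _ _.
  have -> : eval s4 (Var var_o) = o.+1 by [].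
  have -> : eval s4 (Var var_x) = (A o).+1 by [].
  have HA := owners_update (k := arr_A) (s := s3) o (B o) SA2.
  have HB := owners_update (k := arr_B) (s := s4) o (A o) SB2.
  split=> //; split=> //; split=> p; [apply: etrans (HA p) _|apply: etrans (HB p) _];
    rewrite /assign ltnS (leq_eqVlt p) -(inj_eq val_inj) /=;
    case: eqP => //= E; by have -> : p = o by apply: val_inj.
- move=> s2 [St2 Sh2 Sl2 [SA2 SB2]]; split=> // o.
    by rewrite SA2 ltn_ord.
  by rewrite SB2 ltn_ord.
Qed.

Lemma wp_exchange s Q :
  Q (update (update (update s var_r 0 (s var_x 0)) var_x 0 (s var_y 0)) var_y 0 (s var_x 0)) ->
  wp bd exchange s Q.
Proof. by []. Qed.

Variable q : int.

(** From the merging on, the cells of [arr_load] with positive index hold gains instead of loads. *)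
Definition walking A B (a : 'I_n) (s : store) : Prop :=
  [/\ tables s, owners arr_A A s, owners arr_B B s,
      forall x : 'I_n, s arr_load x.+1%:Z = gain q A B x & s var_a 0 = a.+1%:Z].

Definition settled A B (a : 'I_n) : Prop :=
  forall o, A o != B o -> A o != a /\ B o != a.

Lemma wp_select A B a s :
  walking A B a s -> s var_c 0 = 0 ->
  wp bd select s (fun s' => walking A B a s' /\
    (s' var_c 0 = 0 /\ (forall o, A o = B o) \/
     exists c : 'I_m, [/\ s' var_c 0 = c.+1%:Z, A c != B c
       & [\/ A c = a, B c = a | settled A B a]])).
Proof.
move=> W0 c0; rewrite /select.
apply: (wp_for (N := m) (I := fun j s => walking A B a s /\
    (s var_c 0 = 0 /\ (forall o : 'I_m, (o < j)%N -> A o = B o) \/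
     exists c : 'I_m, [/\ s var_c 0 = c.+1%:Z, A c != B c
       & [\/ A c = a, B c = a
           | forall o : 'I_m, (o < j)%N -> A o != B o -> A o != a /\ B o != a]]))) => //.
- by split=> //; left.
- by move=> j s1 [[[]]].
- move=> j s1 jm [W1 H1] o1; pose o := Ordinal jm; have [St SA SB Sg Sa] := W1.
  have split_lt (P : 'I_m -> Prop) : (forall i : 'I_m, (i < j)%N -> P i) -> P o ->
      forall i : 'I_m, (i < j.+1)%N -> P i.
    move=> H Po i; rewrite ltnS leq_eqVlt => /orP[/eqP E|/H //].
    by have -> : i = o by apply: val_inj.
  have oA : eval s1 (Get arr_A (Var var_o)) = (A o).+1 by rewrite /= o1 (SA o).
  have oB : eval s1 (Get arr_B (Var var_o)) = (B o).+1 by rewrite /= o1 (SB o).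
  have va : eval s1 (Var var_a) = a.+1 by [].
  have eqS (x y : 'I_n) : (x.+1%:Z == y.+1%:Z) = (x == y) by [].
  rewrite !(wp_ifeq, wp_if) oA oB va !eqS.
  have [AB|AB] := eqVneq (A o) (B o).
    split=> //; split=> //; case: H1 => [[c1 H1]|[c [c1 ABc H1]]].
      by left; split=> //; exact: split_lt.
    right; exists c; split=> //; case: H1 => H1; [by constructor 1|by constructor 2|].
    by constructor 3; apply: split_lt => //; rewrite AB eqxx.
  have set_c : A o = a \/ B o = a \/ s1 var_c 0 = 0 -> wp bd (Set_ var_c (Var var_o)) s1
    (fun s' => (walking A B a s' /\
    (s' var_c 0 = 0 /\ (forall o : 'I_m, (o < j.+1)%N -> A o = B o) \/
     exists c : 'I_m, [/\ s' var_c 0 = c.+1%:Z, A c != B c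
       & [\/ A c = a, B c = a
           | forall o : 'I_m, (o < j.+1)%N -> A o != B o -> A o != a /\ B o != a]]))
     /\ s' var_o 0 = j.+1).
    move=> H; rewrite wp_put; split=> //; split=> //; right; exists o; split=> //.
    case: H => [?|[?|c1]]; [by constructor 1|by constructor 2|].
    have [Aa|Aa] := eqVneq (A o) a; first by constructor 1.
    have [Ba|Ba] := eqVneq (B o) a; first by constructor 2.
    (* Here [var_c] is still 0, so all earlier items are decided and the condition on them is
       vacuous. *)
    constructor 3; apply: split_lt => // i ij; case: H1 => [[_ ->]|[c []]] //.
      by rewrite eqxx.
    by rewrite c1.
  case: H1 => [[c1 H1]|[c [c1 ABc H1]]].
    by rewrite (_ : eval s1 (Var var_c) = 0) // ltxx; apply: set_c; right; right.
  rewrite (_ : eval s1 (Var var_c) = c.+1) //=.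
  have [Aa|Aa] := eqVneq (A o) a; first by apply: set_c; left.
  have [Ba|Ba] := eqVneq (B o) a; first by apply: set_c; right; left.
  split=> //; split=> //; right; exists c; split=> //.
  case: H1 => H1; [by constructor 1|by constructor 2|constructor 3].
  exact: split_lt.
- move=> s1 [W1 H1]; split=> //; case: H1 => [[c1 H1]|[c [c1 ABc H1]]].
    by left; split=> // o; apply: H1.
  right; exists c; split=> //; case: H1 => H1; [by constructor 1|by constructor 2|constructor 3].
  by move=> o; apply: H1.
Qed.

Lemma wp_resolve A B a (c : 'I_m) s :
  walking A B a s -> walk good q A B a -> s var_c 0 = c.+1%:Z -> A c != B c ->
  [\/ A c = a, B c = a | settled A B a] ->
  wp bd resolve s (fun s' => s' var_c 0 = c.+1%:Z /\
    exists g b, walking (assign A c g) (assign B c g) b s' /\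
      walk good q (assign A c g) (assign B c g) b).
Proof.
move=> W0 Wk c0 ABc H; have [[tn tm tR tv tT] SA SB Sg Sa] := W0.
pose P x y s := [/\ walking A B a s, s var_c 0 = c.+1%:Z, s var_x 0 = (x : 'I_n).+1%:Z
  & s var_y 0 = (y : 'I_n).+1%:Z].
pose ends x y := A c = x /\ B c = y \/ A c = y /\ B c = x.
rewrite /resolve !(wp_seq, wp_put).
have -> : eval s (Get arr_A (Var var_c)) = (A c).+1 by rewrite /= c0 SA.
set s1 := update s _ _ _.
have -> : eval s1 (Get arr_B (Var var_c)) = (B c).+1.
  by rewrite -[LHS]/(s arr_B (s var_c 0)) c0 SB.
set s2 := update s1 _ _ _.
apply: (@wp_mono _ _ _ (fun s => exists x y,
    [/\ P x y s, x != y, ends x y & x = a \/ settled A B a])); last first.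
  rewrite wp_ifeq (_ : eval s2 (Var var_y) = (B c).+1) // (_ : eval s2 (Var var_a) = a.+1) //.
  rewrite (_ : (_ == _) = (B c == a)) //; have [Ba|Ba] := eqVneq (B c) a.
    apply: wp_exchange; exists (B c), (A c); split; first by split.
    - by rewrite eq_sym.
    - by right.
    - by left.
  exists (A c), (B c); split; [by split|by []|by left|].
  by case: H => H; [left|rewrite H eqxx in Ba|right].
move=> {s1 s2} s1 [x [y [[W1 c1 x1 y1] xy AB xa]]].
rewrite wp_seq wp_put (_ : eval s1 (Var var_y) = y.+1) //.
set s2 := update s1 _ _ _; rewrite wp_seq.
have {tn tm tR tv tT SA SB Sg Sa} [[tn tm tR tv tT] SA SB Sg Sa] := W1.
pose g := if (0 < gain q A B x) (+) good x c then x else y.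
pose g' := if (0 < gain q A B x) (+) good x c then y else x.
apply: (@wp_mono _ _ _ (fun s => [/\ walking A B y s, s var_c 0 = c.+1%:Z,
    s var_x 0 = g.+1%:Z & s var_y 0 = g'.+1%:Z])); last first.
  have W2 : walking A B y s2 by [].
  rewrite !wp_if.
  have -> : eval s2 (Get arr_load (Var var_x)) = gain q A B x.
    by rewrite -[LHS]/(s1 arr_load (s1 var_x 0)) x1 Sg.
  have -> : eval s2 (Entry 0 (Var var_x) (Var var_c)) = if good x c then 1 else -1.
    rewrite -[LHS]/(s1 0%N (s1 arr_row (s1 var_x 0) + s1 var_c 0)).
    by rewrite x1 c1 tR tv.
  by rewrite /g /g'; case: (0 < gain q A B x); case: (good x c);
    rewrite ?ltr01 ?oppr_gt0 ?ltr10 //=; try apply: wp_exchange; split.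
move=> {}s2 [W2 c2 x2 y2].
have gg : g != g' by rewrite /g /g'; case: ifP => _ //; rewrite eq_sym.
have AB' : A c = g /\ B c = g' \/ A c = g' /\ B c = g.
  by rewrite /g /g'; case: ifP => _; case: AB => ?; [left|right|right|left].
have {tn tm tR tv tT SA SB Sg Sa} [[tn tm tR tv tT] SA SB Sg Sa] := W2.
rewrite !(wp_seq, wp_put).
have -> : eval s2 (Var var_c) = c.+1 by [].
have -> : eval s2 (Var var_x) = g.+1 by [].
set s3 := update s2 _ _ _.
have -> : eval s3 (Var var_c) = c.+1 by [].
have -> : eval s3 (Var var_x) = g.+1 by [].
set s4 := update s3 _ _ _.
have -> : eval s4 (Var var_x) = g.+1 by [].
have -> : eval s4 (Plus (Get arr_load (Var var_x)) (Entry 0 (Var var_x) (Var var_c)))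
    = gain q A B g + (if good g c then 1 else -1).
  rewrite -[LHS]/(s2 arr_load (s2 var_x 0) + s2 0%N (s2 arr_row (s2 var_x 0) + s2 var_c 0)).
  by rewrite x2 c2 tR tv Sg.
set s5 := update s4 _ _ _.
have -> : eval s5 (Var var_y) = g'.+1 by [].
have -> : eval s5 (Minus (Get arr_load (Var var_y)) (Entry 0 (Var var_y) (Var var_c)))
    = gain q A B g' - (if good g' c then 1 else -1).
  rewrite -[LHS]/(s5 arr_load (s2 var_y 0) - s2 0%N (s2 arr_row (s2 var_y 0) + s2 var_c 0)).
  (* The loser's gain is read after the winner's was overwritten; the two agents differ, so it is
     still the old one. *)
  rewrite y2 c2 tR tv /s5 updateE -[s4 arr_load _]/(s2 arr_load g'.+1) Sg.
  by rewrite (_ : (_ == _) = (g' == g)) // eq_sym (negPf gg).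
split=> //; exists g, y; split; last exact: walk_step Wk xy AB xa.
split=> //.
- exact: (owners_update (k := arr_A) (s := s2)).
- exact: (owners_update (k := arr_B) (s := s3)).
move=> z; rewrite (gain_resolve _ _ _ gg AB').
rewrite updateE (_ : (_ == _) = (z == g')) // /s5 updateE (_ : (z.+1%:Z == _) = (z == g)) //.
rewrite -[s4 arr_load _]/(s2 arr_load z.+1) Sg !(eq_sym _ z).
have [->|_] := eqVneq z g'; first by rewrite eq_sym (negPf gg) mulr0 mulr1 addr0.
by have [->|_] := eqVneq z g; rewrite ?mulr0 ?mulr1 ?subr0 ?addr0.
Qed.

Lemma wp_output A s :
  tables s -> owners arr_A A s ->
  wp bd output s (fun s' => s' 1%N 0 = m%:Z /\ forall o : 'I_m, s' 1%N o.+1%:Z = (A o)%:Z).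
Proof.
move=> St SA; rewrite /output wp_seq wp_put.
apply: (wp_for (N := m) (I := fun j s => [/\ tables s, owners arr_A A s, s 1%N 0 = m%:Z
  & forall o : 'I_m, (o < j)%N -> s 1%N o.+1%:Z = (A o)%:Z])) => //.
- by split=> //; case: St.
- by move=> j s1 [[]].
- move=> j s1 jm [St1 SA1 m1 H1] o1; pose o := Ordinal jm; rewrite wp_put.
  have -> : eval s1 (Var var_o) = o.+1%:Z by [].
  have -> : eval s1 (Minus (Get arr_A (Var var_o)) (Const 1)) = A o.
    by rewrite /= o1 (SA1 o) -addn1 PoszD addrK.
  split=> //; split=> // i; rewrite ltnS leq_eqVlt updateE (_ : (_ == _) = (i == j :> nat)) //.
  by case: eqP => [E _|_ /H1 //]; congr (A _)%:Z; apply: val_inj.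
- by move=> s1 [_ _ m1 H1]; split=> // o; apply: H1.
Qed.

Lemma entry_inj (a b o o' : nat) : (o < m)%N -> (o' < m)%N ->
  ((2 + a * m)%N%:Z + o.+1%:Z == (2 + b * m)%N%:Z + o'.+1%:Z) = (a == b) && (o == o').
Proof.
move=> om om'; rewrite -!PoszD eqz_nat !addnS eqSS -!addnA eqn_add2l.
apply/eqP/andP => [E|[/eqP -> /eqP ->]] //; split.
  have m_gt0 : (0 < m)%N by apply: leq_ltn_trans om.
  by have := congr1 (divn^~ m) E; rewrite /= !divnMDl // !divn_small // !addn0 => ->.
by have := congr1 (modn^~ m) E; rewrite /= !modnMDl !modn_small // => ->.
Qed.

Hypothesis n_gt0 : (0 < n)%N.
Hypothesis potential_bd : (2 * n * ((2 * m).+1 * (2 * n)) < bd)%N.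

Lemma wp_merge A B h s :
  state q A B h s -> (forall p, -1 <= load q A B p <= 0) ->
  wp bd merge s (fun s' => tables s' /\ exists A', owners arr_A A' s' /\
    forall x, share good A' x = q \/ share good A' x = q + 1).
Proof.
move=> S small; rewrite /merge wp_seq.
apply: (wp_for (N := n) (I := fun j s =>
  [/\ tables s, owners arr_A A s, owners arr_B B s
    & loads (fun p : node => if (p.1 < j)%N && p.2 then gain q A B p.1
                             else load q A B p) s])) => //.
- by case: S.
- by move=> j s1 [[]].
- move=> j s1 jn [St SA SB Sl] b1; pose b := Ordinal jn; rewrite wp_put.
  have -> : eval s1 (Var var_b) = code (b, true) by [].
  have -> : eval s1 (Minus (Get arr_load (Var var_b)) (Get arr_load (Opp (Var var_b))))
      = gain q A B b.
    rewrite gain_load /= b1 sub0r.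
    have := Sl (b, true); have := Sl (b, false); rewrite /= ltnn /= => <- <-.
    by [].
  split=> //; split=> // -[a t].
  rewrite (loads_update (b, true) (gain q A B b) Sl) /assign xpair_eqE ltnS (leq_eqVlt a).
  rewrite -(inj_eq val_inj) /=; case: t => /=; rewrite ?andbT ?andbF //.
  by case: eqP => // E; have -> : a = b by apply: val_inj.
move=> s1 [St SA SB Sl]; rewrite !(wp_seq, wp_put).
set s2 := update _ var_c _ _.
pose a0 := Ordinal n_gt0.
pose I k s := exists A B a, [/\ walking A B a s, walk good q A B a,
   0 < s var_c 0 -> (undecided A B < k)%N
 & 0 < s var_c 0 \/ forall o, A o = B o].
(* The measure bounds the number of undecided items strictly. It starts from [m.+1], since the loop
   is entered before any undecided item has been found. *)
have mbd : (m < bd)%N by move: potential_bd; nia.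
apply: (@wp_while _ _ _ I _ _ _ mbd) => //.
- exists A, B, a0; split=> //; last by left.
  + split=> // x; have := Sl (x, true); rewrite /= ltn_ord /= => <-; done.
  + move=> z; have := small (z, true); have := small (z, false).
    by rewrite gain_load; case: (z == a0) => /=; lia.
  + move=> _; rewrite ltnS /undecided -[leqRHS]card_ord -sum1_card.
    by apply: leq_sum => o _; case: (_ != _).
- move=> k s3 [A3 [B3 [a3 [W3 Wk3 lt3 _]]]] c3.
  have {}lt3 := lt3 c3; rewrite wp_seq wp_put wp_seq.
  have W3' : walking A3 B3 a3 (update s3 var_c 0 0) by [].
  apply: wp_mono (wp_select W3' (erefl _)) => s4 [W4 H4].
  rewrite wp_if; case: H4 => [[c4 AB]|[c [c4 ABc H4]]].
    rewrite (_ : eval s4 _ = 0) //; exists 0%N; first by lia.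
    by exists A3, B3, a3; split=> //; [rewrite c4|right].
  have -> : 0 < eval s4 (Var var_c) by rewrite /= c4.
  apply: wp_mono (wp_resolve W4 Wk3 c4 ABc H4) => s5 [c5 [g [b [W5 Wk5]]]].
  exists (undecided A3 B3) => //; exists (assign A3 c g), (assign B3 c g), b.
  split=> //; last by left; rewrite c5.
  by move=> _; apply: undecided_assign.
- move=> k s3 [A3 [B3 [a3 [[St3 SA3 _ _ _] Wk3 _ H3]]]] c3.
  have AB : forall o, A3 o = B3 o by case: H3 => // H3; rewrite /= H3 in c3.
  split=> //; exists A3; split=> // x; exact: walk_end Wk3 AB.
Qed.

Variable K : int.
Hypothesis total : forall a, \sum_o (if good a o then 1 else -1) = K.

Definition loaded (s : store) : Prop :=
  [/\ s 0%N 1 = n%:Z, s 0%N 2 = m%:Z,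
      forall (a : 'I_n) (o : 'I_m),
        s 0%N ((2 + a * m)%N%:Z + o.+1%:Z) = (if good a o then 1 else -1)
    & labels (fun _ : node => 0%N) s].

Definition tabulated (j i : nat) (s : store) : Prop :=
  (forall a : nat, (a <= j)%N -> s arr_row a.+1%:Z = (2 + a * m)%N%:Z) /\
  (forall (a : 'I_n) (o : 'I_m), (a < j)%N || (a == j :> nat) && (o < i)%N ->
     s arr_loc ((2 + a * m)%N%:Z + o.+1%:Z) = code (loc a o)).

Lemma wp_setup s :
  loaded s -> s var_K 0 = 0 ->
  wp bd setup s (fun s' => exists q A h,
    [/\ n%:Z * q <= K, K <= n%:Z * (q + 1) & state q A A h s']).
Proof.
move=> L0 K0; rewrite /setup wp_seq; pose a0 := Ordinal n_gt0.
pose sg o : int := if good a0 o then 1 else -1.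
apply: (wp_for (N := m) (I := fun j s => loaded s /\
  s var_K 0 = \sum_(o < m | (o < j)%N) sg o)) => //.
- by split=> //; rewrite big_pred0.
- by move=> j s1 [[]].
- move=> j s1 jm [L1 K1] o1; pose o := Ordinal jm; have [_ _ tv _] := L1.
  rewrite wp_put; split=> //; split=> //.
  rewrite /= updateE eqxx K1 o1.
  have := tv a0 o; rewrite /= mul0n addn0 => ->.
  rewrite [RHS](bigD1 o) ?ltnSn //= addrC; congr (_ + _).
  by apply: eq_bigl => i; rewrite -(inj_eq val_inj) /= ltnS ltn_neqAle andbC.
move=> s1 [L1 K1].
have {}K1 : s1 var_K 0 = K.
  by rewrite K1 -(total a0); apply: eq_bigl => o; rewrite ltn_ord.
rewrite !(wp_seq, wp_put).
apply: (wp_for (N := n) (I := fun j s => [/\ loaded s, s var_K 0 = K,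
   s var_r 0 = K + (j * m)%N%:Z, s var_q 0 = - m%:Z & tabulated j 0 s])) => //.
- split=> //; first by rewrite mul0n addr0 -K1.
    have [_ m1 _ _] := L1; rewrite -[LHS]/(0 - s1 0%N 2) m1 sub0r; done.
  split; last by move=> a o; rewrite ltn0 andbF.
  by case.
- by move=> j s2 [[]].
- move=> j s2 jn [L2 K2 r2 q2 T2] b2; pose b := Ordinal jn; rewrite wp_seq.
  apply: (wp_for (N := m) (I := fun i s => [/\ loaded s, s var_K 0 = K,
    s var_r 0 = K + (j * m)%N%:Z /\ s var_q 0 = - m%:Z, tabulated j i s
    & s var_b 0 = j.+1])) => //.
  + by move=> i s3 [[]].
  + move=> i s3 im [L3 K3 r3 [R3 T3] b3] o3; pose o := Ordinal im.
    have [_ _ tv _] := L3.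
    have rE : eval s3 (Plus (Get arr_row (Var var_b)) (Var var_o))
       = (2 + j * m)%N%:Z + i.+1%:Z by rewrite /= b3 o3 R3.
    have rule z : z = code (loc b o) ->
        wp bd (Put arr_loc (Plus (Get arr_row (Var var_b)) (Var var_o)) (Const z)) s3
        (fun s' => [/\ loaded s', s' var_K 0 = K,
           s' var_r 0 = K + (j * m)%N%:Z /\ s' var_q 0 = - m%:Z, tabulated j i.+1 s'
           & s' var_b 0 = j.+1] /\ s' var_o 0 = i.+1).
      move=> zE; rewrite wp_put rE; split=> //; split=> //; split=> // a o' H.
      rewrite updateE entry_inj //=; case: ifP => [/andP[/eqP E /eqP E']|ne].
        by rewrite zE; congr (code (loc _ _)); apply: val_inj.
      apply: T3; move: H ne; case: (ltnP a j) => //= _ /andP[-> /=].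
      by rewrite ltnS leq_eqVlt => /orP[->|].
    have oE : eval s3 (Var var_b) = b.+1 by [].
    have oE' : eval s3 (Opp (Var var_b)) = - b.+1%:Z by rewrite /= b3 sub0r.
    rewrite wp_if !wp_put oE oE'.
    have -> : eval s3 (Entry 0 (Var var_b) (Var var_o)) = if good b o then 1 else -1.
      by rewrite -tv /= b3 o3 R3.
    have := rule (code (loc b o)) (erefl _).
    by rewrite wp_put /loc /code /=; case: (good b o).
  + move=> s3 [L3 K3 [r3 q3] [R3 T3] b3]; rewrite wp_seq !wp_put.
    have [_ m3 _ _] := L3.
    have -> : eval s3 (Plus (Var var_b) (Const 1)) = j.+2 by rewrite /= b3; lia.
    have -> : eval s3 (Plus (Get arr_row (Var var_b)) num_items) = (2 + j.+1 * m)%N.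
      by rewrite /= b3 R3 // m3; lia.
    split=> //; split=> //.
      by rewrite -[LHS]/(s3 var_r 0 + s3 0%N 2) r3 m3; lia.
    split=> [a aj|a o].
      rewrite -[LHS]/(update s3 arr_row _ _ arr_row _) updateE eqz_nat !eqSS.
      by case: eqP => [-> //|ne]; apply: R3; lia.
    rewrite andbF orbF ltnS leq_eqVlt => aj; apply: T3.
    by rewrite ltn_ord andbT orbC.
move=> s2 [L2 K2 r2 q2 [R2 T2]]; rewrite wp_seq.
have T2' : tables s2.
  have [? ? ? _] := L2; split=> // [a|a o]; first by apply: R2; exact: ltnW.
  by apply: T2; rewrite ltn_ord.
have Lb2 : labels (fun _ : node => 0%N) s2 by case: L2.
have [Km mK] : - m%:Z <= K /\ K <= m%:Z.
  by have /andP[] := total_bounds total n_gt0.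
(* The remainder serves as its own measure. It starts nonnegative because [K] is at least [- m] and
   there is an agent. *)
pose I k s := [/\ tables s, labels (fun _ : node => 0%N) s, s var_K 0 = K,
  s var_r 0 = k%:Z & K = n%:Z * s var_q 0 + k%:Z].
have r0 : 0 <= K + (n * m)%N%:Z by nia.
apply: (@wp_while _ _ _ I _ `|K + (n * m)%N%:Z|) => //.
- by move: potential_bd; nia.
- split=> //; first by rewrite r2 gez0_abs.
  by rewrite q2 gez0_abs // PoszM; ring.
- move=> k s3 [T3 Lb3 K3 r3 E3]; have [n3 _ _ _ _] := T3.
  move=> kn; have {}kn : (n < k)%N by move: kn; rewrite /= r3 n3; lia.
  rewrite wp_seq !wp_put; exists (k - n)%N; first by lia.
  split=> //.
    by rewrite -[LHS]/(s3 var_r 0 - s3 0%N 1) r3 n3; lia.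
  rewrite -[X in _ = _ * X + _]/(s3 var_q 0 + 1) E3 mulrDr mulr1; lia.
move=> k s3 [T3 Lb3 K3 r3 E3] kn; have [n3 _ _ _ _] := T3.
have {}kn : (k <= n)%N by move: kn; rewrite /= r3 n3; lia.
set q' := s3 var_q 0 in E3; rewrite wp_seq.
apply: (wp_for (N := n) (I := fun j s => [/\ tables s, labels (fun _ : node => 0%N) s,
   s var_K 0 = K, s var_q 0 = q'
   & forall p : node, (p.1 < j)%N -> s arr_load (code p) = offset q' p])) => //.
- by move=> j s4 [[]].
- move=> j s4 jn [T4 Lb4 K4 q4 l4] b4; pose b := Ordinal jn.
  rewrite wp_seq !wp_put.
  have -> : eval s4 (Var var_b) = code (b, true) by [].
  have -> : eval s4 (Minus (Const (-1)) (Var var_q)) = - q' - 1 by rewrite /= q4; lia.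
  set s5 := update s4 _ _ _.
  have -> : eval s5 (Opp (Var var_b)) = code (b, false).
    by rewrite -[LHS]/(0 - s4 var_b 0) b4 sub0r.
  have -> : eval s5 (Var var_q) = q' by [].
  split=> //; split=> // -[a t]; rewrite ltnS leq_eqVlt => /= H.
  rewrite -[LHS]/(update s5 arr_load _ _ arr_load _) updateE /s5 updateE !code_eq.
  rewrite !xpair_eqE -(inj_eq val_inj) /=.
  move: H; case: eqP => [E _|_ /= aj]; last exact: l4.
  by case: t.
move=> s4 [T4 Lb4 K4 q4 l4].
have c1 : 1 = code (a0, true) by [].
have cN1 : -1 = code (a0, false) by [].
rewrite wp_seq wp_put.
have -> : eval s4 (Const 1) = code (a0, true) by [].
have -> : eval s4 (Plus (Get arr_load (Const 1)) (Var var_K)) = - q' - 1 + K.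
  by rewrite /= c1 l4 // K4.
set s5 := update s4 _ _ _; rewrite wp_seq wp_put.
have -> : eval s5 (Const (-1)) = code (a0, false) by [].
have -> : eval s5 (Minus (Get arr_load (Const (-1))) (Var var_K)) = q' - K.
  by rewrite -[LHS]/(s5 arr_load (-1) - s4 var_K 0) cN1 K4 /s5 updateE code_eq /= l4.
set s6 := update s5 _ _ _.
pose A0 (_ : 'I_m) := a0.
(* As the first agent owns all copies, its nodes receive [K] and [- K] on top of the offsets; all
   other nodes have just their offsets. *)
have l6 : loads (load q' A0 A0) s6.
  move=> [a t]; rewrite /s6 updateE code_eq /s5 updateE code_eq.
  rewrite /load /A0 /loc /opp /=.
  under eq_bigr => o _ do rewrite !xpair_eqE /=.
  rewrite !xpair_eqE (eq_sym a); have [<-|ne] := eqVneq a0 a; last first.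
    by rewrite big1 ?add0r /= ?l4 //= => o _; rewrite subrr.
  case: t => /=; rewrite /offset /= -(total a0).
    by rewrite addrC; congr (_ + _); apply: eq_bigr => o _; case: (good a0 o).
  by rewrite addrC -sumrN; congr (_ + _); apply: eq_bigr => o _; case: (good a0 o).
have T6 : tables s6 by [].
have Lb6 : labels (fun _ : node => 0%N) s6 by [].
clearbody s6.
apply: (wp_for (N := m) (I := fun j s => [/\ tables s, labels (fun _ : node => 0%N) s,
   loads (load q' A0 A0) s
   & forall o : 'I_m, (o < j)%N -> s arr_A o.+1%:Z = 1 /\ s arr_B o.+1%:Z = 1])) => //.
- by move=> j s7 [[]].
- move=> j s7 jm [T7 Lb7 l7 H7] o7; rewrite wp_seq !wp_put; split=> //; split=> // o.
  rewrite ltnS leq_eqVlt => oj.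
  rewrite -[X in X = 1 /\ _]/(update s7 arr_A (s7 var_o 0) 1 arr_A o.+1%:Z).
  rewrite -[X in _ /\ X = 1]/(update s7 arr_B (s7 var_o 0) 1 arr_B o.+1%:Z).
  rewrite !updateE o7 eqz_nat eqSS; case: eqP oj => //= _; exact: H7.
- move=> s7 [T7 Lb7 l7 H7]; exists q', A0, (fun=> 0%N); split; [by nia|by nia|].
  by split=> // o; have [] := H7 o (ltn_ord o).
Qed.

End Program.

(** * Correctness *)

Lemma wp_allocate (n m : nat) (good : 'I_n -> 'I_m -> bool) (K : int) bd s :
  (0 < n)%N -> (0 < m)%N -> (n <= bd)%N -> (m <= bd)%N ->
  (2 * n * ((2 * m).+1 * (2 * n)) < bd)%N ->
  (forall a, \sum_o (if good a o then 1 else -1) = K) ->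
  loaded good s -> s var_K 0 = 0 ->
  wp bd allocate s (fun s' => exists q (A : 'I_m -> 'I_n),
    [/\ s' 1%N 0 = m%:Z, forall o : 'I_m, s' 1%N o.+1%:Z = (A o)%:Z
      & forall x, share good A x = q \/ share good A x = q + 1]).
Proof.
move=> n0 m0 nb mb pb total L K0; rewrite /allocate wp_if.
have -> : 0 < eval s num_items by case: L => _ /= -> _ _; rewrite ltz_nat.
rewrite wp_seq; apply: wp_mono (wp_setup nb mb n0 pb total L K0).
move=> s1 [q [A1 [h1 [qK Kq S1]]]].
rewrite wp_seq; apply: wp_mono (wp_balance nb mb total n0 qK Kq pb S1).
move=> s2 [A2 [B2 [h2 [S2 le2 _]]]].
rewrite wp_seq; apply: wp_mono (wp_swap nb mb S2) => s3 S3.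
rewrite wp_seq; apply: wp_mono (wp_balance nb mb total n0 qK Kq pb S3).
move=> s4 [A4 [B4 [h4 [S4 le4 low4]]]].
rewrite wp_seq.
(* The first run gives loads at most 0, the swap turns this into at least -1, and the second run
   restores the upper bound while keeping the lower one. *)
have small p : -1 <= load good q A4 B4 p <= 0.
  rewrite le4 andbT; apply: low4 => x; rewrite load_swap.
  by have := le2 (opp x); lia.
apply: wp_mono (wp_merge nb mb n0 pb S4 small) => s5 [T5 [A5 [O5 H5]]].
apply: wp_mono (wp_output mb T5 O5) => s6 [m6 A6].
by exists q, A5.
Qed.

Lemma nth_allpairs (S T R : Type) (f : S -> T -> R) (s : seq S) (t : seq T) x0 y0 z0 i j :
  (i < size s)%N -> (j < size t)%N ->
  nth z0 [seq f x y | x <- s, y <- t] (i * size t + j) = f (nth x0 s i) (nth y0 t j).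
Proof.
elim: s i => // x s IH [|i] /= si tj; rewrite nth_cat size_map.
  by rewrite mul0n add0n tj (nth_map y0).
by rewrite mulSn -addnA ltnNge leq_addr /= addKn IH.
Qed.

(** * From nearly equal shares to a fair allocation *)

Section Solution.

Variable I : fd_instance.
Hypothesis sym : symmetric_bivalued I.
Local Notation n := (agents I).
Local Notation m := (items I).

Definition likes (i : 'I_n) (o : 'I_m) : bool := 0 < valuation i [set o].

Lemma valuation_likes i o : valuation i [set o] = if likes i o then 1 else -1.
Proof. by rewrite /likes; case: (sym i o) => ->. Qed.

Lemma loaded_input : loaded likes (input (encode_instance I)).
Proof.
split=> // i o; rewrite -PoszD -valuation_likes /= addnS /=.
have := @nth_allpairs _ _ _ (fun i o => valuation i [set o]) (enum 'I_n) (enum 'I_m)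
  i o 0 i o; rewrite !size_enum_ord !nth_ord_enum => -> //.
Qed.

Lemma valuation_setD1 i o (S : {set 'I_m}) : o \in S ->
  valuation i (S :\ o) = valuation i S - (if likes i o then 1 else -1).
Proof.
move=> oS; rewrite (valuation_additive i (S :\ o)) (valuation_additive i S) (big_setD1 o oS) /= valuation_likes.
ring.
Qed.

(** Strictly different values differ by exactly one, so removing any liked item from the richer
    bundle or any disliked item from the poorer one closes the gap. *)
Lemma share_solution (A : 'I_m -> 'I_n) q :
  (forall i, share likes A i = q \/ share likes A i = q + 1) ->
  let X := (fun i => [set o | A o == i]) : bundles I in
  [/\ complete_allocation X, EQX X & EQ1 X].
Proof.
move=> HA X.
have vX i : valuation i (X i) = share likes A i.
  rewrite valuation_additive /share; apply: eq_big => [o|o _]; first by rewrite inE.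
  exact: valuation_likes.
have near i j : valuation i (X i) < valuation j (X j) ->
    valuation j (X j) = valuation i (X i) + 1.
  by rewrite !vX; case: (HA i) => ->; case: (HA j) => ->; lia.
split.
- split=> [i j ij|].
    apply/pred0P => o /=; rewrite !inE; apply/negP => /andP[/eqP -> /eqP E].
    by rewrite E eqxx in ij.
  apply/setP => o; rewrite inE; apply/bigcupP; exists (A o) => //.
  by rewrite inE.
- move=> i j /near E; split=> o oX; rewrite valuation_likes valuation_setD1 // E.
    by case: (likes j o) => //; lia.
  by case: (likes i o) => //; lia.
(* EQ1 also needs an item to remove: a bundle of positive value contains a liked item, and otherwise
   the poorer bundle has negative value and contains a disliked one. *)
move=> i j /near E; have [pos|neg] := ltrP 0 (valuation j (X j)).
  have /existsP[g /andP[gX jg]] : [exists g, (g \in X j) && likes j g].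
    apply/contraT; rewrite negb_exists => /forallP H.
    suff : valuation j (X j) <= 0 by rewrite leNgt pos.
    rewrite valuation_additive; apply: sumr_le0 => o oX; rewrite valuation_likes.
    by have := H o; rewrite oX /= => /negPf ->.
  left; exists g; split=> //; first by rewrite valuation_likes jg.
  by rewrite valuation_setD1 // jg E addrK.
have /existsP[c /andP[cX ic]] : [exists c, (c \in X i) && ~~ likes i c].
  apply/contraT; rewrite negb_exists => /forallP H.
  suff : 0 <= valuation i (X i) by lia.
  rewrite valuation_additive; apply: sumr_ge0 => o oX; rewrite valuation_likes.
  by have := H o; rewrite oX /= negbK => ->.
right; exists c; split=> //; first by rewrite valuation_likes (negPf ic).
by rewrite valuation_setD1 // (negPf ic) E opprK.
Qed.

End Solution.

Lemma size_bit_length w : (2 * size w <= bit_length w)%N.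
Proof.
rewrite /bit_length -sum1_size big_distrr /=.
by apply: leq_sum => z _; rewrite muln1.
Qed.

Lemma allocate_correct (I : fd_instance) bd :
  symmetric_bivalued I -> normalized I ->
  (24 * bit_length (encode_instance I) ^ 2 <= bd)%N ->
  runs bd allocate (input (encode_instance I)) (fun s => exists y, outputs s y /\
    exists A : bundles I, [/\ complete_allocation A, EQX A, EQ1 A & encodes_allocation A y]).
Proof.
move=> sym norm; set L := bit_length _ => Lbd.
have n0 := agents_gt0 I; pose a0 := Ordinal n0.
pose K := valuation a0 [set: 'I_(items I)].
have total (a : 'I_(agents I)) : \sum_o (if likes a o then 1 else -1) = K.
  rewrite /K (norm a0 a) valuation_additive; apply: eq_big => [o|o _]; first by rewrite inE.
  by rewrite valuation_likes.
have finish s q (A : 'I_(items I) -> 'I_(agents I)) :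
    s 1%N 0 = (items I)%:Z -> (forall o : 'I_(items I), s 1%N o.+1%:Z = (A o : nat)%:Z) ->
    (forall x, share (@likes I) A x = q \/ share (@likes I) A x = q + 1) ->
    exists y, outputs s y /\
    exists A : bundles I, [/\ complete_allocation A, EQX A, EQ1 A & encodes_allocation A y].
  move=> s0 sA HA; exists [seq (A o : nat)%:Z | o <- enum 'I_(items I)]; split.
    move=> [|k]; rewrite size_map size_enum_ord //= => km.
    by rewrite (nth_map (Ordinal km)) ?size_enum_ord // -sA (nth_ord_enum _ (Ordinal km)).
  have [X1 X2 X3] := share_solution sym HA.
  exists (fun i => [set o | A o == i]); split=> //.
  split; first by rewrite size_map size_enum_ord.
  move=> i o; rewrite inE => /eqP <-.
  by rewrite (nth_map o) ?size_enum_ord // nth_ord_enum.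
apply: wp_runs.
have [m0|m0] := posnP (items I).
  rewrite /allocate wp_if (_ : eval _ num_items = (items I)%:Z) // m0.
  have noitem (o : 'I_(items I)) : False by case: o => k; rewrite m0.
  apply: (@finish _ 0 (fun o => match noitem o with end)).
  - by rewrite m0.
  - by move=> o; case: (noitem o).
  - by move=> x; left; rewrite /share big1 // => o; case: (noitem o).
have NL : (agents I * items I <= L)%N.
  have := size_bit_length (encode_instance I); rewrite -/L /= size_allpairs !size_enum_ord.
  lia.
have nN : (agents I <= agents I * items I)%N by rewrite leq_pmulr.
have mN : (items I <= agents I * items I)%N by rewrite leq_pmull.
have NN : (24 * (agents I * items I) ^ 2 <= bd)%N.
  by apply: leq_trans Lbd; rewrite leq_mul2l leq_exp2r.
have N2 : (agents I * items I <= (agents I * items I) ^ 2)%N.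
  by rewrite -[leqLHS]expn1 leq_pexp2l // muln_gt0 n0.
apply: wp_mono (wp_allocate n0 m0 _ _ _ total (loaded_input sym) (erefl _)).
- by move=> s [q [A [s0 sA HA]]]; apply: finish s0 sA HA.
- lia.
- lia.
(* For positive [n] and [m], the initial potential [8 * n^2 * m + 4 * n^2] is at most
   [12 * (n * m)^2], so the factor 24 makes the inequality strict. *)
apply: leq_trans NN; rewrite expnMn; move: (agents I) (items I) {a0 K total finish} n0 m0 {nN mN N2 NL} => n m n0 m0.
nia.
Qed.

Theorem theorem4p1 :
  (forall I : fd_instance, symmetric_bivalued I -> normalized I ->
     exists A : bundles I, [/\ complete_allocation A, EQX A & EQ1 A]) /\
  poly_time_solvable
    (fun I : fd_instance => symmetric_bivalued I /\ normalized I)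
    encode_instance
    (fun I w => exists A : bundles I,
       [/\ complete_allocation A, EQX A, EQ1 A & encodes_allocation A w]).
Proof.
split.
  move=> I sym norm.
  have [t [s [_ _ [y [_ [A [? ? ? _]]]]]]] := allocate_correct sym norm (leqnn _).
  by exists A.
have [b [d H]] := time_bound_poly allocate.
(* The constants come from substituting the loop bound [24 * L ^ 2], with [L] the bit length of the
   input, into [b * B ^ d + b]. *)
exists allocate, (b * 24 ^ d + b)%N, (2 * d)%N => I [sym norm].
have [t [s [E T [y [Oy Sy]]]]] := allocate_correct sym norm (leqnn _).
exists t, s, y; split=> //; apply: leq_trans T _.
set L := bit_length _.
have L0 : (0 < L)%N by apply: leq_trans (size_bit_length _).
apply: leq_trans (H _ _) _; first by rewrite muln_gt0 expn_gt0 L0.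
rewrite expnMn -expnM mulnA mulnDl; nia.
Qed.
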